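(* Let $\Delta:\mathbb{T}\to M_N$ be a measurable bounded selfadjoint function (i.e. $\Delta(\gamma)^*=\Delta(\gamma)$ for a.e. $\gamma$) such that $\|\Delta\|_{L_\infty(\mathbb{T};M_N)}<1$. Let $\varepsilon\in[0,1]$. Then (a.e. on $\mathbb{T}$) $$|F_{I+\varepsilon\Delta}(0)|^2=\Big[I-\sum_{n=0}^\infty(-1)^n\varepsilon^{n+1}T_\Delta^n(P_+(\Delta))\Big]^*(I+\varepsilon\Delta)\Big[I-\sum_{n=0}^\infty(-1)^n\varepsilon^{n+1}T_\Delta^n(P_+(\Delta))\Big].$$ In particular, $$|F_{I+\varepsilon\Delta}(0)|^2=I+\varepsilon\widehat{\Delta}(0)-\varepsilon^2\sum_{n\ge1}|\widehat{\Delta}(n)|^2+\mathcal{O}(\varepsilon^3),\qquad\text{as }\varepsilon\to0^+ .$$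
   Context: $\mathbb{D}$ is the open unit disc, $\mathbb{T}$ the unit circle with normalized Lebesgue measure $m$. $M_N$ is the space of complex $N\times N$ matrices with operator norm, $S_2^N$ the same space with the Hilbert–Schmidt norm, $|A|^2=A^*A$, and $\widehat{\Delta}(n)=\int\gamma^{-n}\Delta(\gamma)\,dm(\gamma)$. $H^2(\mathbb{T};S_2^N)$ (resp. $H^2_0(\mathbb{T};S_2^N)$) is the subspace of $f\in L^2(\mathbb{T};S_2^N)$ with $\hat f(n)=0$ for all $n<0$ (resp. all $n\le0$); elements of $H^2(\mathbb{T};S_2^N)$ are identified with their holomorphic extensions to $\mathbb{D}$. $P_+$ is the orthogonal projection of $L^2(\mathbb{T};S_2^N)$ onto $H_0^2(\mathbb{T};S_2^N)$. The Toeplitz-type operator $T_\Delta:H_0^2(\mathbb{T};S_2^N)\to H_0^2(\mathbb{T};S_2^N)$ is $T_\Delta f=P_+(\Delta f)$ (left multiplication by $\Delta$ followed by $P_+$), with $T_\Delta^0$ the identity. The series converge in $H_0^2(\mathbb{T};S_2^N)$. A matrix weight is a measurable $W:\mathbb{T}\to M_N$ with $cI\le W(\gamma)\le CI$ a.e. for some constants $c,C>0$. A right outer function associated to $W$ is an $F\in H^2(\mathbb{T};S_2^N)$ with $F(\gamma)^*F(\gamma)=W(\gamma)$ a.e. and $F\cdot H^2(\mathbb{T};S_2^N)$ dense in $H^2(\mathbb{T};S_2^N)$. Such $F$ exists (Helson–Lowdenslager) and is unique up to left multiplication by a constant unitary matrix; $F_W$ denotes the unique one with $F_W(0)$ positive.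 *)

(* Defs.v *)
From HB Require Import structures.
From mathcomp Require Import all_boot all_order all_algebra.
From mathcomp Require Import sesquilinear spectral.
From mathcomp Require Import all_classical all_reals all_analysis.
From mathcomp Require Import measurable_realfun ess_sup_inf.
From mathcomp Require Import complex.

Set Implicit Arguments.
Unset Strict Implicit.
Unset Printing Implicit Defensive.

Import Order.TTheory GRing.Theory Num.Theory.
Import numFieldNormedType.Exports.

Local Open Scope classical_set_scope.
Local Open Scope ring_scope.
Local Open Scope complex_scope.
Local Open Scope sesquilinear_scope.

(* [R[i]] with the topology of its modulus, so that [limn] and [-->] are
   available for complex matrices. *)
HB.instance Definition _ (R : realType) := NormedModule.copy R[i] R[i]^o.

Definition circle (R : realType) : Type := {z : R[i] | `|z| == 1}.

Section Circle.
Variable R : realType.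

Lemma expi_subproof (t : R) : `|cos (2 * pi * t) +i* sin (2 * pi * t)| == 1 :> R[i].
Proof. by rewrite normc_def/= cos2Dsin2 sqrtr1. Qed.

(* [expi t] is exp(2 pi i t). *)
Definition expi (t : R) : circle R :=
  exist (fun z : R[i] => `|z| == 1) _ (expi_subproof t).

HB.instance Definition _ := gen_eqMixin (circle R).
HB.instance Definition _ := gen_choiceMixin (circle R).
HB.instance Definition _ := isPointed.Build (circle R) (expi 0).

Definition circle_coord (z : circle R) : R * R :=
  (complex.Re (sval z), complex.Im (sval z)).


(* The Borel sigma-algebra of the circle, i.e. the trace of that of the plane. *)
HB.instance Definition _ :=
  Measurable.copy (circle R) (g_sigma_algebra_preimageType circle_coord).

Lemma measurable_expi : measurable_fun [set: R] expi.
Proof.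
move=> _ _ [B mB <-]; rewrite !setTI -comp_preimage -[X in measurable X]setTI.
have mcoord : measurable_fun setT (circle_coord \o expi).
  apply/measurable_fun_pairP; split; apply: continuous_measurable_fun => t.
  - have /continuous_comp : {for t, continuous ( *%R (2 * pi : R))}.
      exact: mulrl_continuous.
    by apply; exact: continuous_cos.
  - have /continuous_comp : {for t, continuous ( *%R (2 * pi : R))}.
      exact: mulrl_continuous.
    by apply; exact: continuous_sin.
exact: mcoord.
Qed.

(* Normalized Lebesgue measure: the law of [expi t] for [t] uniform on [0, 1]. *)
Definition unit_lebesgue := mrestr lebesgue_measure (measurable_itv `[(0 : R), 1]).

HB.instance Definition _ := Measure.on unit_lebesgue.

Definition circle_measure : set (circle R) -> \bar R :=
  pushforward unit_lebesgue expi.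

Let circle_measure0 : circle_measure set0 = 0%E.
Proof. by rewrite /circle_measure /pushforward preimage_set0 measure0. Qed.

Let circle_measure_ge0 A : (0 <= circle_measure A)%E.
Proof. by rewrite /circle_measure /pushforward measure_ge0. Qed.

Let circle_measure_sigma_additive : semi_sigma_additive circle_measure.
Proof.
move=> F mF tF mUF; rewrite /circle_measure /pushforward preimage_bigcup.
have mexpi A : measurable A -> measurable (expi @^-1` A).
  by move=> mA; rewrite -[X in measurable X]setTI; exact: measurable_expi.
apply: measure_semi_sigma_additive.
- by move=> n; exact: mexpi.
- apply/trivIsetP => /= i j _ _ ij; rewrite -preimage_setI.
  by move/trivIsetP : tF => /(_ _ _ _ _ ij) ->//; rewrite preimage_set0.
- by rewrite -preimage_bigcup; exact: mexpi.
Qed.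

HB.instance Definition _ := isMeasure.Build _ _ _ circle_measure
  circle_measure0 circle_measure_ge0 circle_measure_sigma_additive.

Let circle_measure_setT : circle_measure setT = 1%E.
Proof.
rewrite /circle_measure /pushforward /unit_lebesgue /mrestr preimage_setT setTI.
by rewrite lebesgue_measure_itv/= lte01 oppr0 adde0.
Qed.

HB.instance Definition _ :=
  Measure_isProbability.Build _ _ _ circle_measure circle_measure_setT.

End Circle.

Section MatrixNorms.
Variable R : realType.

Definition hsnorm (m n : nat) (A : 'M[R[i]]_(m, n)) : R :=
  Num.sqrt (\sum_(i < m) \sum_(j < n) complex.Re `|A i j| ^+ 2).

(* On columns, [hsnorm] is the Euclidean norm. *)
Definition opnorm (n : nat) (A : 'M[R[i]]_n) : R :=
  sup [set hsnorm (A *m x) | x in [set x : 'cV[R[i]]_n | hsnorm x <= 1]].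

Definition abs2 (n : nat) (A : 'M[R[i]]_n) : 'M[R[i]]_n := A^t* *m A.

(* In [R[i]], [0 <= z] says that [z] is real and nonnegative, hence a positive
   matrix is selfadjoint. *)
Definition positive_mx (n : nat) (A : 'M[R[i]]_n) : Prop :=
  forall x : 'cV[R[i]]_n, 0 <= (x^t* *m A *m x) 0 0.

End MatrixNorms.

Section Hardy.
Variables (R : realType) (N : nat).

Local Notation T := (circle R).
Local Notation m := (@circle_measure R).
Local Notation M := 'M[R[i]]_N.
Implicit Types (f g h F W Delta : T -> M).

(* Elements of function spaces are represented by functions, equality being
   equality almost everywhere. *)

Definition measurable_mx f : Prop := forall i j,
  measurable_fun setT (fun z => complex.Re (f z i j)) /\
  measurable_fun setT (fun z => complex.Im (f z i j)).

Definition cintegral (u : T -> R[i]) : R[i] :=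
  (\int[m]_z complex.Re (u z)) +i* (\int[m]_z complex.Im (u z)).

Definition fourier f (n : int) : M :=
  \matrix_(i, j) cintegral (fun z => sval z ^ (- n) * f z i j).

Definition normL2 f : \bar R := 'N[m]_2%:E[(fun z => (hsnorm (f z))%:E)].

Definition L2 : set (T -> M) := [set f | measurable_mx f /\ (normL2 f < +oo)%E].

Definition innerL2 f g : R[i] := cintegral (fun z => \tr ((g z)^t* *m f z)).

Definition H2 : set (T -> M) :=
  [set f | L2 f /\ forall n : int, n < 0 -> fourier f n = 0].

Definition H20 : set (T -> M) :=
  [set f | L2 f /\ forall n : int, n <= 0 -> fourier f n = 0].

(* The holomorphic extension to the open unit disc of an element of [H2]. *)
Definition holext f (z : R[i]) : M :=
  limn (fun k => \sum_(n < k) z ^+ n *: fourier f n%:Z).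

(* The orthogonal projection of [L2] onto [H20]. *)
Definition Pplus f : T -> M :=
  xget (fun=> 0) [set g | H20 g /\
    forall h, H20 h -> innerL2 (fun z => f z - g z) h = 0].

Definition toeplitz Delta f : T -> M := Pplus (fun z => Delta z *m f z).

(* [S] is the sum, in the Hilbert space [H20], of the series of general term [u]. *)
Definition is_sum_H20 (u : nat -> T -> M) (S : T -> M) : Prop :=
  [/\ forall n, H20 (u n), H20 S &
      normL2 (fun z => S z - \sum_(n < k) u n z) @[k --> \oo] --> 0%E].

Definition right_outer W F : Prop :=
  [/\ H2 F,
      {ae m, forall z, (F z)^t* *m F z = W z} &
      forall g, H2 g -> forall e : R, 0 < e -> exists2 h, H2 h &
        (normL2 (fun z => (F z *m h z - g z)%R) < e%:E)%E].

(* [F] is the function F_W, for a matrix weight [W]. *)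
Definition is_normalized_outer W F : Prop :=
  right_outer W F /\ positive_mx (holext F 0).

Definition perturbation Delta (e : R) : T -> M :=
  fun z => 1%:M + e%:C *: Delta z.

Definition neumann_term Delta (e : R) (n : nat) : T -> M :=
  fun z => ((-1) ^+ n * e%:C ^+ n.+1) *: iter n (toeplitz Delta) (Pplus Delta) z.

End Hardy.

(* Main.v *)
Require Import Defs.
From HB Require Import structures.
From mathcomp Require Import all_boot all_order all_algebra.
From mathcomp Require Import sesquilinear spectral.
From mathcomp Require Import all_classical all_reals all_analysis.
From mathcomp Require Import measurable_realfun ess_sup_inf.
From mathcomp Require Import complex.
From mathcomp Require Import ring lra zify.

Set Implicit Arguments.
Unset Strict Implicit.
Unset Printing Implicit Defensive.

Import Order.TTheory GRing.Theory Num.Theory.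
Import numFieldNormedType.Exports.

Local Open Scope classical_set_scope.
Local Open Scope ring_scope.
Local Open Scope complex_scope.
Local Open Scope sesquilinear_scope.

(* Write W = I + e Delta, S = sum_n (-1)^n e^(n+1) T_Delta^n (P_+ Delta) and
   G = I - S. Summing the Neumann series gives (I + e T_Delta) S = e P_+ Delta,
   that is, W G is orthogonal to H^2_0. If F is outer with F^* F = W, then
   <F G, F z h> = <W G, z h> = 0 for every h in H^2, so by density of F H^2 the
   function F G, which lies in H^2, is orthogonal to z H^2. Hence F G is constant,
   equal to F(0) G(0) = F(0), and F(0)^* F(0) = G^* F^* F G = G^* W G.
   Integrating this identity yields
     |F(0)|^2 = I + e Delta^(0) - e^2 (<P, P> - <Delta S, P>),  P = P_+ Delta,
   where <P, P> = sum_(n >= 1) |Delta^(n)|^2 by Parseval and |S| = O(e).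

   Completeness of L^2 yields P_+ and S. That H^2, defined by vanishing Fourier
   coefficients, is closed under bounded products requires that an integrable
   function with vanishing Fourier coefficients be 0 almost everywhere. *)

(** * Matrix norms *)

(** [Pplus] is a choice of a function characterised by its pairings with [H20], so the identity I +
    e T_Delta is not inverted as an operator. Everything is tested against [h] in [H20], where
    [P_+ f] may be replaced by [f]; selfadjointness then moves Delta onto [h], and passing to the
    limit needs continuity of the pairing in one argument only. Convergence of the series rests on
    |Delta| <= d < 1 alone, the powers of e being bounded by 1; this is why e = 1 is included. A
    product of two square integrable functions is a priori only integrable. Reading a bound on F off
    F^* F = W makes F G square integrable, and replacing G by its Fourier partial sums shows that no
    negative frequency appears. Bessel makes these sums converge to some function; uniqueness of
    coefficients identifies it with G. The expansion comes from an exact identity. The mean of Delta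
    S is <S, P>, which the weak Neumann equation tested at P expresses again through <P, P> and
    <Delta S, P>; the error is therefore exactly e^2 <Delta S, P>. The same equation tested at S
    gives |S| <= e |Delta| / (1 - d). *)

Section MatrixAlgebra.
Variable R : realType.
Local Notation C := R[i].

Lemma ReD (x y : C) : complex.Re (x + y) = complex.Re x + complex.Re y.
Proof. by case: x y => [a b] [c d]. Qed.

Lemma ImD (x y : C) : complex.Im (x + y) = complex.Im x + complex.Im y.
Proof. by case: x y => [a b] [c d]. Qed.

Lemma ReN (x : C) : complex.Re (- x) = - complex.Re x.
Proof. by case: x. Qed.

Lemma ImN (x : C) : complex.Im (- x) = - complex.Im x.
Proof. by case: x. Qed.

Lemma ReM (x y : C) : complex.Re (x * y) =
  complex.Re x * complex.Re y - complex.Im x * complex.Im y.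
Proof. by case: x y => [a b] [c d]. Qed.

Lemma ImM (x y : C) : complex.Im (x * y) =
  complex.Re x * complex.Im y + complex.Im x * complex.Re y.
Proof. by case: x y => [a b] [c d]. Qed.

Lemma ReJ (x : C) : complex.Re (x^*)%C = complex.Re x.
Proof. by case: x. Qed.

Lemma ImJ (x : C) : complex.Im (x^*)%C = - complex.Im x.
Proof. by case: x. Qed.

Lemma Re_sum (I : Type) (r : seq I) (P : pred I) (F : I -> C) :
  complex.Re (\sum_(i <- r | P i) F i) = \sum_(i <- r | P i) complex.Re (F i).
Proof. by apply: (big_morph _ ReD). Qed.

Lemma complexP (x y : C) :
  complex.Re x = complex.Re y -> complex.Im x = complex.Im y -> x = y.
Proof. by case: x y => [a b] [c d] /= -> ->. Qed.

Definition sqmod (x : C) : R := complex.Re x ^+ 2 + complex.Im x ^+ 2.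

Lemma sqmod_ge0 x : 0 <= sqmod x.
Proof. by rewrite addr_ge0 ?sqr_ge0. Qed.

Lemma sqmodM x y : sqmod (x * y) = sqmod x * sqmod y.
Proof. by rewrite /sqmod ReM ImM; ring. Qed.

Lemma sqmodE x : (sqmod x)%:C = x * (x^*)%C.
Proof. by apply: complexP; rewrite ?ReM ?ImM ReJ ImJ /= /sqmod; ring. Qed.

Lemma sqmod_norm x : (sqmod x)%:C = `|x| ^+ 2.
Proof. by rewrite -add_Re2_Im2. Qed.

(** Cauchy-Schwarz for [dotmx], applied to the conjugate of [b] because [dotmx] conjugates its
    second argument. *)
Lemma sqmod_sumM n (a b : 'I_n -> C) :
  sqmod (\sum_k a k * b k) <= (\sum_k sqmod (a k)) * \sum_k sqmod (b k).
Proof.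
pose u := \row_k a k; pose v := \row_k (b k)^*%C.
have : `|dotmx u v| ^+ 2 <= dotmx u u * dotmx v v.
  exact: (CauchySchwarz (@dotmx C n) u v).1.
have E (w : 'rV[C]_n) : dotmx w w = (\sum_k sqmod (w 0 k))%:C.
  rewrite dotmxE mxE rmorph_sum; apply: eq_bigr => k _.
  by rewrite !mxE; exact/esym/sqmodE.
have -> : dotmx u v = \sum_k a k * b k.
  by rewrite dotmxE mxE; apply: eq_bigr => k _; rewrite !mxE [X in _ * X]conjcK.
rewrite -sqmod_norm !E -rmorphM lecR.
congr (_ <= _ * _); apply: eq_bigr => k _; rewrite !mxE //.
by rewrite /sqmod ReJ ImJ sqrrN.
Qed.

Lemma hsnorm_ge0 m n (A : 'M[C]_(m, n)) : 0 <= hsnorm A.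
Proof. exact: sqrtr_ge0. Qed.

Lemma hsnorm_sqr m n (A : 'M[C]_(m, n)) :
  hsnorm A ^+ 2 = \sum_i \sum_j sqmod (A i j).
Proof.
rewrite sqr_sqrtr; last by do 2!apply: sumr_ge0 => ? _; rewrite sqr_ge0.
do 2!apply: eq_bigr => ? _.
by rewrite normc_def/= sqr_sqrtr // addr_ge0 ?sqr_ge0.
Qed.

Lemma hsnorm_le m n (A : 'M[C]_(m, n)) (x : R) :
  0 <= x -> (hsnorm A <= x) = (\sum_i \sum_j sqmod (A i j) <= x ^+ 2).
Proof. by move=> x0; rewrite -hsnorm_sqr ler_sqr ?nnegrE// hsnorm_ge0. Qed.

Lemma hsnorm_mul m n p (A : 'M[C]_(m, n)) (B : 'M[C]_(n, p)) :
  hsnorm (A *m B) <= hsnorm A * hsnorm B.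
Proof.
rewrite hsnorm_le ?mulr_ge0 ?hsnorm_ge0// exprMn !hsnorm_sqr.
rewrite mulr_suml; apply: ler_sum => i _.
rewrite [X in _ * X]exchange_big mulr_sumr; apply: ler_sum => j _.
by rewrite mxE; exact: sqmod_sumM.
Qed.

Lemma hsnorm_conj m n (A : 'M[C]_(m, n)) : hsnorm (A^t*) = hsnorm A.
Proof.
apply/eqP; rewrite -(@eqrXn2 _ 2) ?hsnorm_ge0// !hsnorm_sqr exchange_big; apply/eqP.
do 2!apply: eq_bigr => ? _; rewrite !mxE.
by rewrite /sqmod [complex.Re _]ReJ [complex.Im _]ImJ sqrrN.
Qed.

Lemma sqmod_le_hsnorm m n (A : 'M[C]_(m, n)) i j : sqmod (A i j) <= hsnorm A ^+ 2.
Proof.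
rewrite hsnorm_sqr (bigD1 i)//= (bigD1 j)//= -addrA lerDl addr_ge0//.
  by apply: sumr_ge0 => ? _; exact: sqmod_ge0.
by do 2!apply: sumr_ge0 => ? _; exact: sqmod_ge0.
Qed.

Lemma normRe_le_hsnorm m n (A : 'M[C]_(m, n)) i j :
  `|complex.Re (A i j)| <= hsnorm A.
Proof.
rewrite -ler_sqr ?nnegrE ?hsnorm_ge0// real_normK ?num_real//.
by apply: le_trans (sqmod_le_hsnorm A i j); rewrite lerDl sqr_ge0.
Qed.

Lemma normIm_le_hsnorm m n (A : 'M[C]_(m, n)) i j :
  `|complex.Im (A i j)| <= hsnorm A.
Proof.
rewrite -ler_sqr ?nnegrE ?hsnorm_ge0// real_normK ?num_real//.
by apply: le_trans (sqmod_le_hsnorm A i j); rewrite lerDr sqr_ge0.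
Qed.

(** The l^2 norm is at most the l^1 norm, applied to the entries of a row and then to the rows. It
    turns entrywise estimates into a norm estimate. *)
Lemma hsnorm_le_sum m n (A : 'M[C]_(m, n)) :
  hsnorm A <= \sum_i \sum_j (`|complex.Re (A i j)| + `|complex.Im (A i j)|).
Proof.
have p0 i j : 0 <= `|complex.Re (A i j)| + `|complex.Im (A i j)|.
  by rewrite addr_ge0.
have sqr_sum (I : finType) (F : I -> R) : (forall i, 0 <= F i) ->
    \sum_i F i ^+ 2 <= (\sum_i F i) ^+ 2.
  move=> F0; rewrite expr2 mulr_suml; apply: ler_sum => i _.
  by rewrite expr2 ler_wpM2l// (bigD1 i)//= lerDl sumr_ge0.
rewrite hsnorm_le; last by do 2!apply: sumr_ge0 => ? _; exact: p0.
apply: le_trans (sqr_sum _ _ _); last by move=> i; apply: sumr_ge0 => ? _; exact: p0.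
apply: ler_sum => i _; apply: le_trans (sqr_sum _ _ (p0 i)).
apply: ler_sum => j _; rewrite /sqmod -[X in X + _]real_normK ?num_real//.
rewrite -[X in _ + X]real_normK ?num_real// sqrrD lerD2r lerDl.
by rewrite mulrn_wge0// mulr_ge0.
Qed.

(** Parallelogram law with the square of A - B dropped. It gives stability of [L2] under sums before
    any triangle inequality is available. *)
Lemma hsnormD_sqr m n (A B : 'M[C]_(m, n)) :
  hsnorm (A + B) ^+ 2 <= 2 * hsnorm A ^+ 2 + 2 * hsnorm B ^+ 2.
Proof.
rewrite !hsnorm_sqr !mulr_sumr -big_split; apply: ler_sum => i _.
rewrite !mulr_sumr -big_split; apply: ler_sum => j _ /=.
rewrite mxE /sqmod ReD ImD -subr_ge0.
set a := complex.Re _; set b := complex.Re _; set c := complex.Im _.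
set d := complex.Im _.
have -> : 2 * (a ^+ 2 + c ^+ 2) + 2 * (b ^+ 2 + d ^+ 2) -
  ((a + b) ^+ 2 + (c + d) ^+ 2) = (a - b) ^+ 2 + (c - d) ^+ 2 by ring.
by rewrite addr_ge0 ?sqr_ge0.
Qed.

Lemma hsnorm_scale m n (c : C) (A : 'M[C]_(m, n)) :
  hsnorm (c *: A) ^+ 2 = sqmod c * hsnorm A ^+ 2.
Proof.
rewrite !hsnorm_sqr mulr_sumr; apply: eq_bigr => i _.
by rewrite mulr_sumr; apply: eq_bigr => j _; rewrite mxE sqmodM.
Qed.

Lemma hsnorm_scaleR m n (t : R) (A : 'M[C]_(m, n)) : 0 <= t ->
  hsnorm (t%:C *: A) = t * hsnorm A.
Proof.
move=> t0; apply/eqP; rewrite -(@eqrXn2 _ 2) ?mulr_ge0 ?hsnorm_ge0//.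
by rewrite hsnorm_scale exprMn /sqmod/= expr0n/= addr0.
Qed.

Lemma hsnorm0 m n : hsnorm (0 : 'M[C]_(m, n)) = 0.
Proof.
apply/eqP; rewrite -sqrf_eq0 hsnorm_sqr big1// => i _.
by rewrite big1// => j _; rewrite mxE /sqmod /= expr0n/= addr0.
Qed.

Lemma hsnorm_eq0 m n (A : 'M[C]_(m, n)) : hsnorm A = 0 -> A = 0.
Proof.
move=> A0; apply/matrixP => i j; rewrite mxE; apply: complexP; apply/eqP.
  by rewrite -normr_le0 -A0 normRe_le_hsnorm.
by rewrite -normr_le0 -A0 normIm_le_hsnorm.
Qed.

Lemma hsnorm_col m n (A : 'M[C]_(m, n)) :
  hsnorm A ^+ 2 = \sum_j hsnorm (col j A) ^+ 2.
Proof.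
rewrite hsnorm_sqr exchange_big; apply: eq_bigr => j _.
by rewrite hsnorm_sqr; apply: eq_bigr => i _; rewrite big_ord1 mxE.
Qed.

Lemma has_sup_opnorm n (A : 'M[C]_n) :
  has_sup [set hsnorm (A *m x) | x in [set x : 'cV[C]_n | hsnorm x <= 1]].
Proof.
split; first by exists (hsnorm (A *m (0 : 'cV[C]_n))), 0 => //=; rewrite hsnorm0 ler01.
exists (hsnorm A) => _ [x /= x1 <-].
by apply: le_trans (hsnorm_mul _ _) _; rewrite ler_piMr ?hsnorm_ge0.
Qed.

Lemma opnorm_ge0 n (A : 'M[C]_n) : 0 <= opnorm A.
Proof.
apply: ub_le_sup; first by case: (has_sup_opnorm A).
by exists 0 => /=; rewrite ?mulmx0 hsnorm0 ?ler01.
Qed.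

Lemma opnorm_le_hsnorm n (A : 'M[C]_n) : opnorm A <= hsnorm A.
Proof.
apply: ge_sup; first by case: (has_sup_opnorm A).
move=> _ [x /= x1 <-].
by apply: le_trans (hsnorm_mul _ _) _; rewrite ler_piMr ?hsnorm_ge0.
Qed.

Lemma hsnorm_mulV n (A : 'M[C]_n) (x : 'cV[C]_n) :
  hsnorm (A *m x) <= opnorm A * hsnorm x.
Proof.
have [/hsnorm_eq0 ->|x0] := eqVneq (hsnorm x) 0.
  by rewrite mulmx0 !hsnorm0 mulr0.
have xp : 0 < hsnorm x by rewrite lt_def x0 hsnorm_ge0.
have hsr := fun y : 'cV[C]_n => hsnorm_scaleR y (ltW (etrans (invr_gt0 _) xp)).
rewrite -ler_pdivrMr// mulrC -hsr scalemxAr.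
apply: ub_le_sup; first by case: (has_sup_opnorm A).
by exists ((hsnorm x)^-1%:C *: x) => //=; rewrite hsr mulVf.
Qed.

(** The squared Hilbert-Schmidt norm is the sum over the columns, and [A] acts on each column of [B]
    separately. *)
Lemma hsnorm_opnorm n (A B : 'M[C]_n) : hsnorm (A *m B) <= opnorm A * hsnorm B.
Proof.
rewrite -ler_sqr ?nnegrE ?mulr_ge0 ?opnorm_ge0 ?hsnorm_ge0// exprMn !hsnorm_col.
rewrite mulr_sumr; apply: ler_sum => j _; rewrite -exprMn ler_sqr ?nnegrE.
- by rewrite colE -mulmxA -colE hsnorm_mulV.
- exact: hsnorm_ge0.
- by rewrite mulr_ge0 ?opnorm_ge0 ?hsnorm_ge0.
Qed.

Lemma conjmxM m n p (A : 'M[C]_(m, n)) (B : 'M[C]_(n, p)) :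
  (A *m B)^t* = B^t* *m A^t*.
Proof. by rewrite trmx_mul map_mxM. Qed.

Lemma conjmxK m n (A : 'M[C]_(m, n)) : (A^t*)^t* = A.
Proof. by apply/matrixP => i j; rewrite !mxE conjCK. Qed.

Lemma conjmxD m n (A B : 'M[C]_(m, n)) : (A + B)^t* = A^t* + B^t*.
Proof. by apply/matrixP => i j; rewrite !mxE rmorphD. Qed.

Lemma conjmxB m n (A B : 'M[C]_(m, n)) : (A - B)^t* = A^t* - B^t*.
Proof. by apply/matrixP => i j; rewrite !mxE rmorphB. Qed.

Lemma conjmxZ m n c (A : 'M[C]_(m, n)) : (c *: A)^t* = Num.conj c *: A^t*.
Proof. by apply/matrixP => i j; rewrite !mxE rmorphM. Qed.

Lemma conjmx_scalar n c : (c%:M : 'M[C]_n)^t* = (Num.conj c)%:M.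
Proof. by apply/matrixP => i j; rewrite !mxE rmorphMn eq_sym. Qed.

Lemma trace_abs2 n (A : 'M[C]_n) : complex.Re (\tr (A^t* *m A)) = hsnorm A ^+ 2.
Proof.
rewrite hsnorm_sqr exchange_big Re_sum; apply: eq_bigr => j _.
rewrite mxE Re_sum; apply: eq_bigr => i _.
by rewrite !mxE mulrC; have /(congr1 (@complex.Re R)) := sqmodE (A i j); move=> <-.
Qed.

End MatrixAlgebra.

(** * Square integrable matrix functions *)

Section ComplexIntegral.
Variable R : realType.
Local Notation T := (circle R).
Local Notation m := (@circle_measure R).
Local Notation C := R[i].
Implicit Types (u v : T -> C) (a b : T -> R).

Definition rintegrable a := m.-integrable setT (EFin \o a).

Lemma rintegrable_measurable a : rintegrable a -> measurable_fun setT a.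
Proof. by move=> /integrableP[/measurable_EFinP]. Qed.

Lemma EFin_Rintegral a : rintegrable a ->
  (\int[m]_z (a z)%:E)%E = (\int[m]_z a z)%:E.
Proof. by move=> ia; rewrite fineK//; exact: (integrable_fin_num measurableT ia). Qed.

Lemma rintegrable_le a b : measurable_fun setT a -> rintegrable b ->
  {ae m, forall z, `|a z| <= b z} -> rintegrable a.
Proof.
move=> ma ib ab; apply/integrableP; split; first exact/measurable_EFinP.
have [mb ioo] := integrableP _ _ _ ib.
apply: le_lt_trans ioo; apply: ae_ge0_le_integral => //.
- by apply/measurable_EFinP; apply: measurableT_comp => //.
- by apply: measurableT_comp => //.
- apply: filterS ab => z abz _; rewrite /= lee_fin.
  by apply: le_trans abz (ler_norm _).
Qed.

Lemma rintegrableD a b : rintegrable a -> rintegrable b ->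
  rintegrable (fun z => a z + b z).
Proof. by move=> ia ib; exact: (integrableD measurableT ia ib). Qed.

Lemma rintegrableZ k a : rintegrable a -> rintegrable (fun z => k * a z).
Proof. by move=> ia; exact: (integrableZl measurableT k ia). Qed.

Lemma rintegrableN a : rintegrable a -> rintegrable (fun z => - a z).
Proof.
by move=> ia; under eq_fun do rewrite -mulN1r; exact: rintegrableZ.
Qed.

Lemma rintegrableB a b : rintegrable a -> rintegrable b ->
  rintegrable (fun z => a z - b z).
Proof. by move=> ia ib; apply/rintegrableD/rintegrableN. Qed.

Lemma rintegrable_cst k : rintegrable (fun=> k).
Proof. exact: finite_measure_integrable_cst. Qed.

Lemma Rintegral_circle_cst k : \int[m]_z k = k.
Proof.
rewrite Rintegral_cst// [X in fine X](_ : _ = 1%E) ?mulr1//.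
exact: probability_setT.
Qed.

Lemma ae_le_Rintegral a b : rintegrable a -> rintegrable b ->
  {ae m, forall z, 0 <= a z <= b z} -> \int[m]_z a z <= \int[m]_z b z.
Proof.
move=> ia ib ab.
(* The almost everywhere comparison of integrals is applied to functions that are nonnegative
   everywhere, so both sides are first replaced by their absolute values. *)
have H c : rintegrable c -> {ae m, forall z, 0 <= c z} ->
    (\int[m]_z c z = \int[m]_z `|c z|)%R.
  move=> ic c0; congr fine; have mc := rintegrable_measurable ic.
  apply: ae_eq_integral => //; try exact/measurable_EFinP.
    by apply/measurable_EFinP; exact: measurableT_comp.
  by apply: filterS c0 => z c0 _; rewrite ger0_norm.
rewrite (H a)//; last by apply: filterS ab => z /andP[].
rewrite (H b)//; last by apply: filterS ab => z /andP[]; exact: le_trans.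
have In c : rintegrable c -> (\int[m]_z `|c z|%:E)%E \is a fin_num.
  by move=> ic; apply: integrable_fin_num => //; exact: integrable_norm.
apply: fine_le; rewrite ?In//.
have := rintegrable_measurable ia; have := rintegrable_measurable ib => mb ma.
apply: ae_ge0_le_integral => //; try by move=> z _; rewrite lee_fin.
- by apply/measurable_EFinP; exact: measurableT_comp.
- by apply/measurable_EFinP; exact: measurableT_comp.
- apply: filterS ab => z /andP[a0 ab] _; rewrite lee_fin !ger0_norm//.
  exact: le_trans ab.
Qed.

Lemma ae_eq_Rintegral a b : measurable_fun setT a -> measurable_fun setT b ->
  {ae m, forall z, a z = b z} -> \int[m]_z a z = \int[m]_z b z.
Proof.
move=> ma mb ab; congr fine; apply: ae_eq_integral => //.
- exact/measurable_EFinP.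
- exact/measurable_EFinP.
- by apply: filterS ab => z /= -> _.
Qed.

Definition cmeasurable u := measurable_fun setT (fun z => complex.Re (u z)) /\
  measurable_fun setT (fun z => complex.Im (u z)).

Lemma cmeasurableD u v : cmeasurable u -> cmeasurable v ->
  cmeasurable (fun z => u z + v z).
Proof.
move=> [ru iu] [rv iv]; split.
- by under eq_fun do rewrite ReD; exact: measurable_funD.
- by under eq_fun do rewrite ImD; exact: measurable_funD.
Qed.

Lemma cmeasurableM u v : cmeasurable u -> cmeasurable v ->
  cmeasurable (fun z => u z * v z).
Proof.
move=> [ru iu] [rv iv]; split.
- by under eq_fun do rewrite ReM; apply: measurable_funB; exact: measurable_funM.
- by under eq_fun do rewrite ImM; apply: measurable_funD; exact: measurable_funM.
Qed.

Lemma cmeasurableJ u : cmeasurable u -> cmeasurable (fun z => (u z)^*%C).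
Proof.
move=> [ru iu]; split; first by under eq_fun do rewrite ReJ.
under eq_fun do rewrite ImJ.
exact: measurableT_comp.
Qed.

Lemma cmeasurable_cst c : cmeasurable (fun=> c).
Proof. by split; exact: measurable_cst. Qed.

Lemma cmeasurable_sum (I : Type) (r : seq I) (u : I -> T -> C) :
  (forall i, cmeasurable (u i)) -> cmeasurable (fun z => \sum_(i <- r) u i z).
Proof.
move=> mu; elim: r => [|i r IH].
  by under eq_fun do rewrite big_nil; exact: cmeasurable_cst.
by under eq_fun do rewrite big_cons; exact: cmeasurableD.
Qed.

Lemma cmeasurable_sqmod u : cmeasurable u -> measurable_fun setT (fun z => sqmod (u z)).
Proof. by move=> [ru iu]; apply: measurable_funD; exact: measurable_funX. Qed.

Lemma cmeasurable_circle_coord (u : C -> C) :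
  measurable_fun setT (fun p : R * R => complex.Re (u (p.1 +i* p.2))) ->
  measurable_fun setT (fun p : R * R => complex.Im (u (p.1 +i* p.2))) ->
  cmeasurable (fun z => u (sval z)).
Proof.
have mc : measurable_fun setT (@circle_coord R).
  by move=> _ B mB; exists B.
move=> mr mi; split.
- rewrite (_ : (fun z => _) = (fun p : R * R => complex.Re (u (p.1 +i* p.2))) \o
    (@circle_coord R)); first exact: measurableT_comp.
  by apply/funext => -[[x y] ?].
- rewrite (_ : (fun z => _) = (fun p : R * R => complex.Im (u (p.1 +i* p.2))) \o
    (@circle_coord R)); first exact: measurableT_comp.
  by apply/funext => -[[x y] ?].
Qed.

Lemma cmeasurable_sval : cmeasurable (fun z : T => sval z).
Proof.
by apply: (@cmeasurable_circle_coord id); [exact: measurable_fst|exact: measurable_snd].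
Qed.

Lemma circle_conj (z : T) : (sval z)^*%C = (sval z)^-1.
Proof. by case: z => z /= /eqP z1; rewrite invc_norm z1 expr1n invr1 mul1r. Qed.

Lemma circle_neq0 (z : T) : sval z != 0.
Proof. by case: z => z /= /eqP z1; rewrite -normr_eq0 z1 oner_eq0. Qed.

Lemma cmeasurable_exprz (n : int) : cmeasurable (fun z : T => (sval z ^ n)%R).
Proof.
have H k : cmeasurable (fun z : T => sval z ^+ k).
  elim: k => [|k IH]; first exact: cmeasurable_cst.
  by under eq_fun do rewrite exprS; apply: cmeasurableM => //; exact: cmeasurable_sval.
case: n => n; first exact: H.
(* On the circle inversion is conjugation, so negative powers are conjugates of positive ones. *)
rewrite (_ : (fun z => _) = (fun z => (sval z ^+ n.+1)^*%C)).
  exact: cmeasurableJ.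
by apply/funext => z; rewrite NegzE rmorphXn/= circle_conj exprVn.
Qed.

Lemma circle_conjXz (z : T) (n : int) : ((sval z ^ n)%R)^*%C = (sval z ^ (- n))%R.
Proof.
rewrite -exprz_inv -circle_conj; apply: rmorphXz.
by rewrite unitfE circle_neq0.
Qed.

Definition cintegrable u := rintegrable (fun z => complex.Re (u z)) /\
  rintegrable (fun z => complex.Im (u z)).

Lemma cintegrable_measurable u : cintegrable u -> cmeasurable u.
Proof. by move=> [iu iv]; split; exact: rintegrable_measurable. Qed.

Lemma cintegrableD u v : cintegrable u -> cintegrable v ->
  cintegrable (fun z => u z + v z).
Proof.
move=> [ru iu] [rv iv]; split.
- by under eq_fun do rewrite ReD; exact: rintegrableD.
- by under eq_fun do rewrite ImD; exact: rintegrableD.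
Qed.

Lemma cintegralD u v : cintegrable u -> cintegrable v ->
  cintegral (fun z => u z + v z) = cintegral u + cintegral v.
Proof.
move=> [ru iu] [rv iv]; apply: complexP => /=.
- by under eq_Rintegral do rewrite ReD; exact: RintegralD.
- by under eq_Rintegral do rewrite ImD; exact: RintegralD.
Qed.

Lemma cintegrableZ c u : cintegrable u -> cintegrable (fun z => c * u z).
Proof.
move=> [ru iu]; split.
- by under eq_fun do rewrite ReM; apply: rintegrableB; exact: rintegrableZ.
- by under eq_fun do rewrite ImM; apply: rintegrableD; exact: rintegrableZ.
Qed.

Lemma cintegralZ c u : cintegrable u ->
  cintegral (fun z => c * u z) = c * cintegral u.
Proof.
move=> [ru iu]; apply: complexP; rewrite ?ReM ?ImM/=.
- under eq_Rintegral do rewrite ReM.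
  by rewrite RintegralB ?RintegralZl//; exact: rintegrableZ.
- under eq_Rintegral do rewrite ImM.
  by rewrite RintegralD ?RintegralZl//; exact: rintegrableZ.
Qed.

Lemma cintegrable_sum (I : Type) (r : seq I) (u : I -> T -> C) :
  (forall i, cintegrable (u i)) -> cintegrable (fun z => \sum_(i <- r) u i z).
Proof.
move=> iu; elim: r => [|i r IH].
  by under eq_fun do rewrite big_nil; split; exact: rintegrable_cst.
by under eq_fun do rewrite big_cons; exact: cintegrableD.
Qed.

Lemma cintegral_cst c : cintegral (fun=> c) = c :> C.
Proof. by apply: complexP; rewrite /= Rintegral_circle_cst. Qed.

Lemma cintegral_sum (I : Type) (r : seq I) (u : I -> T -> C) :
  (forall i, cintegrable (u i)) ->
  cintegral (fun z => \sum_(i <- r) u i z) = \sum_(i <- r) cintegral (u i).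
Proof.
move=> iu; elim: r => [|i r IH].
  under eq_fun do rewrite big_nil.
  by rewrite big_nil cintegral_cst.
under eq_fun do rewrite big_cons.
by rewrite big_cons cintegralD ?IH//; exact: cintegrable_sum.
Qed.

Lemma cintegralJ u : cintegrable u ->
  cintegral (fun z => (u z)^*%C) = (cintegral u)^*%C.
Proof.
move=> [ru iu]; apply: complexP; rewrite ?ReJ ?ImJ/=.
  by under eq_Rintegral do rewrite ReJ.
under eq_Rintegral do rewrite ImJ -mulN1r.
by rewrite RintegralZl// mulN1r.
Qed.

Lemma cintegrable_le u b : cmeasurable u -> rintegrable b ->
  {ae m, forall z, `|complex.Re (u z)| <= b z /\ `|complex.Im (u z)| <= b z} ->
  cintegrable u.
Proof.
move=> [ru iu] ib ub; split; apply: rintegrable_le ib _ => //.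
- by apply: filterS ub => z [].
- by apply: filterS ub => z [].
Qed.

Lemma ae_eq_cintegral u v : cmeasurable u -> cmeasurable v ->
  {ae m, forall z, u z = v z} -> cintegral u = cintegral v.
Proof.
move=> [ru iu] [rv iv] uv; apply: complexP => /=; apply: ae_eq_Rintegral => //.
- by apply: filterS uv => z ->.
- by apply: filterS uv => z ->.
Qed.

End ComplexIntegral.

HB.lock Definition nrm2 (R : realType) (N : nat) (f : circle R -> 'M[R[i]]_N) : R :=
  \int[@circle_measure R]_z (hsnorm (f z) ^+ 2).

Section SquareIntegrable.
Variables (R : realType) (N : nat).
Local Notation T := (circle R).
Local Notation m := (@circle_measure R).
Local Notation C := R[i].
Local Notation M := 'M[C]_N.
Implicit Types (f g h : T -> M) (u : T -> C).

Lemma measurable_mx_cst (A : M) : measurable_mx (fun=> A).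
Proof. by move=> i j; exact: cmeasurable_cst. Qed.

Lemma measurable_mxD f g : measurable_mx f -> measurable_mx g ->
  measurable_mx (fun z => f z + g z).
Proof.
move=> mf mg i j; rewrite -/(cmeasurable (fun z => (f z + g z) i j)).
under eq_fun do rewrite mxE.
exact: cmeasurableD (mf i j) (mg i j).
Qed.

Lemma measurable_mxZ u f : cmeasurable u -> measurable_mx f ->
  measurable_mx (fun z => u z *: f z).
Proof.
move=> mu mf i j; rewrite -/(cmeasurable (fun z => (u z *: f z) i j)).
by under eq_fun do rewrite mxE; exact: cmeasurableM.
Qed.

Lemma measurable_mxN f : measurable_mx f -> measurable_mx (fun z => - f z).
Proof.
move=> mf; under eq_fun do rewrite -scaleN1r.
exact: measurable_mxZ (cmeasurable_cst _) mf.
Qed.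

Lemma measurable_mxB f g : measurable_mx f -> measurable_mx g ->
  measurable_mx (fun z => f z - g z).
Proof. by move=> mf mg; apply/measurable_mxD/measurable_mxN. Qed.

Lemma measurable_mxM f g : measurable_mx f -> measurable_mx g ->
  measurable_mx (fun z => f z *m g z).
Proof.
move=> mf mg i j; rewrite -/(cmeasurable (fun z => (f z *m g z) i j)).
under eq_fun do rewrite mxE; apply: cmeasurable_sum => k.
by apply: cmeasurableM; [exact: mf|exact: mg].
Qed.

Lemma measurable_mxJ f : measurable_mx f -> measurable_mx (fun z => (f z)^t*).
Proof.
move=> mf i j; rewrite -/(cmeasurable (fun z => (f z)^t* i j)).
by under eq_fun do rewrite !mxE; apply: cmeasurableJ; exact: mf.
Qed.

Lemma measurable_hsnorm_sqr f : measurable_mx f ->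
  measurable_fun setT (fun z => hsnorm (f z) ^+ 2).
Proof.
move=> mf; under eq_fun do rewrite hsnorm_sqr.
apply: measurable_sum => i; apply: measurable_sum => j.
exact: cmeasurable_sqmod (mf i j).
Qed.

Lemma measurable_hsnorm f : measurable_mx f ->
  measurable_fun setT (fun z => hsnorm (f z)).
Proof.
move=> mf; rewrite (_ : (fun z => _) = Num.sqrt \o (fun z => hsnorm (f z) ^+ 2)).
  apply: measurableT_comp; last exact: measurable_hsnorm_sqr.
  exact: continuous_measurable_fun (@sqrt_continuous R).
by apply/funext => z /=; rewrite sqrtr_sqr ger0_norm// hsnorm_ge0.
Qed.

Definition mintegrable f := forall i j, cintegrable (fun z => f z i j).

Definition mintegral f : M := \matrix_(i, j) cintegral (fun z => f z i j).

Lemma mintegrable_le f (b : T -> R) : measurable_mx f -> rintegrable b ->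
  {ae m, forall z, hsnorm (f z) <= b z} -> mintegrable f.
Proof.
move=> mf ib fb i j; apply: cintegrable_le ib _; first exact: (mf i j).
apply: filterS fb => z fb; split.
- by apply: le_trans fb; exact: normRe_le_hsnorm.
- by apply: le_trans fb; exact: normIm_le_hsnorm.
Qed.

Lemma mintegralD f g : mintegrable f -> mintegrable g ->
  mintegral (fun z => f z + g z) = mintegral f + mintegral g.
Proof.
move=> mf mg; apply/matrixP => i j; rewrite !mxE -cintegralD//.
by under eq_fun do rewrite mxE.
Qed.

Lemma mintegralMl (A : M) f : mintegrable f ->
  mintegral (fun z => A *m f z) = A *m mintegral f.
Proof.
move=> mf; apply/matrixP => i j; rewrite !mxE.
under eq_fun do rewrite mxE.
rewrite cintegral_sum; last by move=> k; exact: cintegrableZ.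
by apply: eq_bigr => k _; rewrite cintegralZ// !mxE.
Qed.

Lemma mintegralMr f (A : M) : mintegrable f ->
  mintegral (fun z => f z *m A) = mintegral f *m A.
Proof.
move=> mf; apply/matrixP => i j; rewrite !mxE.
under eq_fun do rewrite mxE.
rewrite cintegral_sum => [|k].
  apply: eq_bigr => k _; under eq_fun do rewrite mulrC.
  by rewrite cintegralZ// !mxE mulrC.
by under eq_fun do rewrite mulrC; exact: cintegrableZ.
Qed.

Lemma mintegralJ f : mintegrable f ->
  mintegral (fun z => (f z)^t*) = (mintegral f)^t*.
Proof.
move=> mf; apply/matrixP => i j; rewrite !mxE.
under eq_fun do rewrite !mxE.
exact: cintegralJ.
Qed.

Lemma mintegral_cst (A : M) : mintegral (fun=> A) = A.
Proof. by apply/matrixP => i j; rewrite mxE cintegral_cst. Qed.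

Lemma ae_eq_mintegral f g : measurable_mx f -> measurable_mx g ->
  {ae m, forall z, f z = g z} -> mintegral f = mintegral g.
Proof.
move=> mf mg fg; apply/matrixP => i j; rewrite !mxE.
apply: ae_eq_cintegral; [exact: (mf i j)|exact: (mg i j)|].
by apply: filterS fg => z ->.
Qed.

Definition nrm f : R := Num.sqrt (nrm2 f).

Lemma nrm2_ge0 f : 0 <= nrm2 f.
Proof. by rewrite nrm2.unlock; apply: Rintegral_ge0 => z _; rewrite sqr_ge0. Qed.

Lemma nrm_ge0 f : 0 <= nrm f.
Proof. exact: sqrtr_ge0. Qed.

Lemma nrm_sqr f : nrm f ^+ 2 = nrm2 f.
Proof. by rewrite sqr_sqrtr// nrm2_ge0. Qed.

Lemma normL2E f :
  normL2 f = ((\int[m]_z (hsnorm (f z) ^+ 2)%:E) `^ 2^-1)%E.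
Proof.
rewrite /normL2 unlock; congr (_ `^ _)%E; apply: eq_integral => z _.
by rewrite abse_EFin poweR_EFin ger0_norm ?hsnorm_ge0// powR_mulrn// hsnorm_ge0.
Qed.

Lemma L2P f : L2 f <->
  measurable_mx f /\ rintegrable (fun z => hsnorm (f z) ^+ 2).
Proof.
have E : (\int[m]_z `|(hsnorm (f z) ^+ 2)%:E| =
    \int[m]_z (hsnorm (f z) ^+ 2)%:E)%E.
  by apply: eq_integral => z _; rewrite gee0_abs// lee_fin sqr_ge0.
split => [[mf nf]|[mf /integrableP[_ ioo]]]; split => //.
  move: nf; rewrite normL2E => nf; apply/integrableP; split.
    exact/measurable_EFinP/measurable_hsnorm_sqr.
  rewrite [X in (X < _)%E]E; exact: lty_poweRy nf.
by rewrite normL2E poweR_lty// -E.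
Qed.

Lemma L2_measurable f : L2 f -> measurable_mx f.
Proof. by move=> []. Qed.

Lemma L2_integrable f : L2 f -> rintegrable (fun z => hsnorm (f z) ^+ 2).
Proof. by move=> /L2P[]. Qed.

Lemma normL2_nrm f : L2 f -> normL2 f = (nrm f)%:E.
Proof.
move=> /L2_integrable fi; rewrite normL2E.
rewrite -[X in (X `^ _)%E]fineK; last exact: integrable_fin_num.
rewrite poweR_EFin powR12_sqrt /nrm ?nrm2.unlock//.
by have := nrm2_ge0 f; rewrite nrm2.unlock.
Qed.

Lemma L2_le f (b : T -> R) : measurable_mx f -> rintegrable b ->
  {ae m, forall z, hsnorm (f z) ^+ 2 <= b z} -> L2 f.
Proof.
move=> mf ib fb; apply/L2P; split=> //; apply: rintegrable_le ib _.
  exact: measurable_hsnorm_sqr.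
by apply: filterS fb => z; rewrite ger0_norm// sqr_ge0.
Qed.

Lemma L2_cst (A : M) : L2 (fun=> A).
Proof.
apply: L2_le (rintegrable_cst (hsnorm A ^+ 2)) _; first exact: measurable_mx_cst.
by apply: aeW.
Qed.

Lemma L2D f g : L2 f -> L2 g -> L2 (fun z => f z + g z).
Proof.
move=> /L2P[mf fi] /L2P[mg gi]; apply: L2_le (rintegrableD
  (rintegrableZ 2 fi) (rintegrableZ 2 gi)) _; first exact: measurable_mxD.
by apply: aeW => z; exact: hsnormD_sqr.
Qed.

Lemma L2M_bounded (D : T -> M) (k : R) f : measurable_mx D -> L2 f ->
  {ae m, forall z, opnorm (D z) <= k} -> L2 (fun z => D z *m f z).
Proof.
move=> mD /L2P[mf fi] Dk; apply: L2_le (rintegrableZ (k ^+ 2) fi) _.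
  exact: measurable_mxM.
apply: filterS Dk => z Dz; rewrite -exprMn ler_sqr ?nnegrE ?hsnorm_ge0//.
  by apply: le_trans (hsnorm_opnorm _ _) _; rewrite ler_wpM2r ?hsnorm_ge0.
by rewrite mulr_ge0 ?hsnorm_ge0// (le_trans _ Dz)// opnorm_ge0.
Qed.

Lemma L2Z u (k : R) f : cmeasurable u -> (forall z, sqmod (u z) <= k) ->
  L2 f -> L2 (fun z => u z *: f z).
Proof.
move=> mu uk /L2P[mf fi]; apply: L2_le (rintegrableZ k fi) _.
  exact: measurable_mxZ.
by apply: aeW => z; rewrite hsnorm_scale ler_wpM2r// sqr_ge0.
Qed.

Lemma L2Zc c f : L2 f -> L2 (fun z => c *: f z).
Proof. by apply: (@L2Z (fun=> c) (sqmod c)) => //; exact: cmeasurable_cst. Qed.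

Lemma L2N f : L2 f -> L2 (fun z => - f z).
Proof. by move=> /(L2Zc (-1)); under eq_fun do rewrite scaleN1r. Qed.

Lemma L2B f g : L2 f -> L2 g -> L2 (fun z => f z - g z).
Proof. by move=> f2 g2; apply/L2D/L2N. Qed.

Lemma L2Mr f (A : M) : L2 f -> L2 (fun z => f z *m A).
Proof.
move=> /L2P[mf fi]; apply: L2_le (rintegrableZ (hsnorm A ^+ 2) fi) _.
  exact: measurable_mxM mf (measurable_mx_cst A).
apply: aeW => z; rewrite -exprMn ler_sqr ?nnegrE ?mulr_ge0 ?hsnorm_ge0//.
by rewrite mulrC hsnorm_mul.
Qed.

Lemma L2J f : L2 f -> L2 (fun z => (f z)^t*).
Proof.
move=> /L2P[mf fi]; apply/L2P; split; first exact: measurable_mxJ.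
by under eq_fun do rewrite hsnorm_conj.
Qed.

Lemma L2_sum (I : Type) (r : seq I) (f : I -> T -> M) :
  (forall i, L2 (f i)) -> L2 (fun z => \sum_(i <- r) f i z).
Proof.
move=> f2; elim: r => [|i r IH].
  by under eq_fun do rewrite big_nil; exact: L2_cst.
by under eq_fun do rewrite big_cons; exact: L2D.
Qed.

Lemma sqmod_circle (z : T) (n : int) : sqmod ((sval z ^ n)%R : C) = 1.
Proof.
have h (c : C) : `|c| = 1 -> sqmod c = 1.
  by move=> c1; have := sqmod_norm c; rewrite c1 expr1n => -[].
have z1 : `|sval z| = 1 by apply/eqP; case: z.
apply: h; case: n => n; rewrite ?NegzE /exprz ?normrV ?unitfE ?expf_neq0 ?circle_neq0//.
  by rewrite normrX z1 expr1n.
by rewrite normrX z1 expr1n invr1.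
Qed.

Lemma L2_shift n f : L2 f -> L2 (fun z => (sval z ^ n)%R *: f z).
Proof.
apply: (@L2Z _ 1); first exact: cmeasurable_exprz.
by move=> z; rewrite sqmod_circle.
Qed.

(** Pointwise |g f| <= |g| |f| <= |f|^2 + |g|^2. *)
Lemma mintegrable_L2M f g : L2 f -> L2 g -> mintegrable (fun z => g z *m f z).
Proof.
move=> /L2P[mf fi] /L2P[mg gi]; apply: mintegrable_le (rintegrableD fi gi) _.
  exact: measurable_mxM.
apply: aeW => z; apply: le_trans (hsnorm_mul _ _) _.
have := hsnorm_ge0 (f z); have := hsnorm_ge0 (g z).
set a := hsnorm _; set b := hsnorm _ => a0 b0.
by have := sqr_ge0 (a - b); have := sqr_ge0 a; have := sqr_ge0 b; rewrite sqrrB; lra.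
Qed.

End SquareIntegrable.

(* Matrix-valued inner product: [innerL2] is its trace, and a subspace which is
   stable under right multiplication by constant matrices has the same
   orthogonal for both. *)
HB.lock Definition gram (R : realType) (N : nat)
    (f g : circle R -> 'M[R[i]]_N) : 'M[R[i]]_N :=
  mintegral (fun z => (g z)^t* *m f z).

Section Gram.
Variables (R : realType) (N : nat).
Local Notation T := (circle R).
Local Notation m := (@circle_measure R).
Local Notation C := R[i].
Local Notation M := 'M[C]_N.
Implicit Types (f g h : T -> M) (u : T -> C).

Lemma gramE f g : gram f g = mintegral (fun z => (g z)^t* *m f z).
Proof. by rewrite unlock. Qed.

Lemma mintegrable_gram f g : L2 f -> L2 g ->
  mintegrable (fun z => (g z)^t* *m f z).
Proof. by move=> f2 g2; exact/mintegrable_L2M/L2J. Qed.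

Lemma gramC f g : L2 f -> L2 g -> gram g f = (gram f g)^t*.
Proof.
move=> f2 g2; rewrite !gramE -mintegralJ; last exact: mintegrable_gram.
by congr mintegral; apply/funext => z; rewrite conjmxM conjmxK.
Qed.

Lemma gramDl f g h : L2 f -> L2 g -> L2 h ->
  gram (fun z => f z + g z) h = gram f h + gram g h.
Proof.
move=> f2 g2 h2; rewrite !gramE -mintegralD; [|exact: mintegrable_gram..].
by congr mintegral; apply/funext => z; rewrite mulmxDr.
Qed.

Lemma gramMr f (A : M) g : L2 f -> L2 g ->
  gram (fun z => f z *m A) g = gram f g *m A.
Proof.
move=> f2 g2; rewrite !gramE -mintegralMr; last exact: mintegrable_gram.
by congr mintegral; apply/funext => z; rewrite mulmxA.
Qed.

Lemma gramZl c f g : L2 f -> L2 g -> gram (fun z => c *: f z) g = c *: gram f g.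
Proof.
move=> f2 g2.
rewrite (_ : (fun z => c *: f z) = (fun z => f z *m c%:M)).
  by rewrite gramMr// mul_mx_scalar.
by apply/funext => z; rewrite mul_mx_scalar.
Qed.

Lemma gramNl f g : L2 f -> L2 g -> gram (fun z => - f z) g = - gram f g.
Proof.
move=> f2 g2.
rewrite (_ : (fun z => - f z) = (fun z => -1 *: f z)).
  by rewrite gramZl// scaleN1r.
by apply/funext => z; rewrite scaleN1r.
Qed.

Lemma gramBl f g h : L2 f -> L2 g -> L2 h ->
  gram (fun z => f z - g z) h = gram f h - gram g h.
Proof. by move=> f2 g2 h2; rewrite gramDl ?gramNl//; exact: L2N. Qed.

Lemma gramDr f g h : L2 f -> L2 g -> L2 h ->
  gram h (fun z => f z + g z) = gram h f + gram h g.
Proof.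
move=> f2 g2 h2; rewrite gramC ?gramDl ?conjmxD//; last exact: L2D.
by rewrite -!gramC.
Qed.

Lemma gramBr f g h : L2 f -> L2 g -> L2 h ->
  gram h (fun z => f z - g z) = gram h f - gram h g.
Proof.
move=> f2 g2 h2; rewrite gramC ?gramBl ?conjmxB//; last exact: L2B.
by rewrite -!gramC.
Qed.

Lemma gramMr_conj f (A : M) g : L2 f -> L2 g ->
  gram f (fun z => g z *m A) = A^t* *m gram f g.
Proof.
move=> f2 g2; rewrite gramC ?gramMr ?conjmxM//; last exact: L2Mr.
by rewrite -!gramC.
Qed.

Lemma gramZr c f g : L2 f -> L2 g ->
  gram f (fun z => c *: g z) = Num.conj c *: gram f g.
Proof.
move=> f2 g2; rewrite gramC ?gramZl ?conjmxZ//; last exact: L2Zc.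
by rewrite -!gramC.
Qed.

Lemma gram_suml (I : Type) (r : seq I) (f : I -> T -> M) g :
  (forall i, L2 (f i)) -> L2 g ->
  gram (fun z => \sum_(i <- r) f i z) g = \sum_(i <- r) gram (f i) g.
Proof.
move=> f2 g2; elim: r => [|i r IH].
  rewrite big_nil -[RHS](mintegral_cst (0 : M)) gramE; congr mintegral.
  by apply/funext => z; rewrite big_nil mulmx0.
rewrite (_ : (fun z => _) = (fun z => f i z + \sum_(i <- r) f i z)).
  by rewrite gramDl ?IH ?big_cons//; exact: L2_sum.
by apply/funext => z; rewrite big_cons.
Qed.

Lemma gram_sum_ord (f : nat -> T -> M) k g : (forall i, L2 (f i)) -> L2 g ->
  gram (fun z => \sum_(i < k) f i z) g = \sum_(i < k) gram (f i) g.
Proof. by move=> f2 g2; exact: (gram_suml _ (fun i : 'I_k => f2 i) g2). Qed.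

Lemma gram_adj (D : T -> M) f g :
  gram (fun z => D z *m f z) g = gram f (fun z => (D z)^t* *m g z).
Proof.
rewrite !gramE; congr mintegral; apply/funext => z.
by rewrite conjmxM conjmxK mulmxA.
Qed.

Lemma gram_ae f f' g g' : measurable_mx f -> measurable_mx f' ->
  measurable_mx g -> measurable_mx g' -> {ae m, forall z, f z = f' z} ->
  {ae m, forall z, g z = g' z} -> gram f g = gram f' g'.
Proof.
move=> mf mf' mg mg' ff' gg'; rewrite !gramE; apply: ae_eq_mintegral.
- exact: measurable_mxM (measurable_mxJ mg) mf.
- exact: measurable_mxM (measurable_mxJ mg') mf'.
- by apply: filterS2 ff' gg' => z -> ->.
Qed.

Lemma gram_shift n f g :
  gram (fun z => (sval z ^ n)%R *: f z) g = gram f (fun z => (sval z ^ (- n))%R *: g z).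
Proof.
rewrite !gramE; congr mintegral; apply/funext => z.
by rewrite conjmxZ [X in X *: _ *m _]circle_conjXz opprK -scalemxAl -scalemxAr.
Qed.

Lemma innerL2E f g : L2 f -> L2 g -> innerL2 f g = \tr (gram f g).
Proof.
move=> f2 g2; rewrite /innerL2 /mxtrace cintegral_sum; last first.
  by move=> i; exact: mintegrable_gram.
by apply: eq_bigr => i _; rewrite gramE mxE.
Qed.

Lemma nrm2E f : L2 f -> nrm2 f = complex.Re (\tr (gram f f)).
Proof.
move=> f2; rewrite -innerL2E// nrm2.unlock/=; congr fine; apply: eq_integral => z _.
by rewrite trace_abs2.
Qed.

(** The adjoint of the elementary matrix E_ij selects the entry (i, j) under the trace. Entries of
    [gram] thus reduce to the scalar product [innerL2]. *)
Lemma gram_entry f g i j : L2 f -> L2 g ->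
  gram f g i j = \tr (gram f (fun z => g z *m delta_mx i j)).
Proof.
move=> f2 g2; have dE k l : (delta_mx i j : M)^t* k l = ((l == i) && (k == j))%:R.
  by rewrite !mxE; case: andb; rewrite ?conjC1 ?conjC0.
rewrite gramMr_conj// /mxtrace (bigD1 j)//= big1 => [|k kj].
  rewrite addr0 [RHS]mxE (bigD1 i)//= big1 => [|l li].
    by rewrite dE !eqxx mul1r addr0.
  by rewrite dE (negPf li) mul0r.
by rewrite mxE big1// => l _; rewrite dE (negPf kj) andbF mul0r.
Qed.

Lemma nrm2D f g : L2 f -> L2 g -> nrm2 (fun z => f z + g z) =
  nrm2 f + 2 * complex.Re (\tr (gram f g)) + nrm2 g.
Proof.
move=> f2 g2; have fg := L2D f2 g2.
rewrite !nrm2E// gramDl// !gramDr// !mxtraceD !ReD (gramC f2 g2).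
rewrite (_ : complex.Re (\tr ((gram f g)^t*)) = complex.Re (\tr (gram f g))).
  by rewrite mulr_natl mulr2n !addrA.
by rewrite !Re_sum; apply: eq_bigr => i _; rewrite !mxE [LHS]ReJ.
Qed.

Lemma nrm2Z c f : L2 f -> nrm2 (fun z => c *: f z) = sqmod c * nrm2 f.
Proof.
move=> f2; rewrite nrm2.unlock -RintegralZl//; last exact: L2_integrable.
by under eq_Rintegral do rewrite hsnorm_scale.
Qed.

Lemma nrmN f : nrm (fun z => - f z) = nrm f.
Proof.
rewrite /nrm nrm2.unlock; congr (Num.sqrt (fine _)); apply: eq_integral => z _.
by rewrite -scaleN1r hsnorm_scale /sqmod/= oppr0 expr0n sqrrN expr1n addr0 mul1r.
Qed.

Lemma nrm2_Zr (t : R) f : L2 f -> nrm2 (fun z => t%:C *: f z) = t ^+ 2 * nrm2 f.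
Proof. by move=> f2; rewrite nrm2Z// /sqmod/= expr0n addr0. Qed.

(** The squared norm of f - t g is a nonnegative quadratic polynomial in the real variable t. *)
Lemma CauchySchwarz_Re f g : L2 f -> L2 g ->
  complex.Re (\tr (gram f g)) <= nrm f * nrm g.
Proof.
move=> f2 g2; set b := complex.Re _.
have H (t : R) : 0 <= nrm2 f - 2 * t * b + t ^+ 2 * nrm2 g.
  have tg := L2Zc (- t)%:C g2.
  rewrite (_ : _ + _ = nrm2 (fun z => f z + (- t)%:C *: g z)) ?nrm2_ge0//.
  rewrite nrm2D// nrm2_Zr// gramZr// sqrrN; congr (_ + _ + _).
  rewrite -mulrA -mulrN; congr (_ * _).
  rewrite (_ : Num.conj _ = (- t)%:C); last exact: conjc_real.
  by rewrite mxtraceZ ReM/= mul0r subr0 mulNr.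
rewrite -!nrm_sqr in H.
have := nrm_ge0 f; have := nrm_ge0 g.
move: H; set x := nrm f; set y := nrm g => H y0 x0.
have [y00|yn0] := eqVneq y 0.
  rewrite y00 mulr0; case: leP => // b0.
  (* When g has norm 0 the polynomial is affine; this t solves 2 t b = x^2 + 1 and would give it the
     value -1. *)
  have := H ((x ^+ 2 + 1) / (2 * b)); rewrite y00 expr0n mulr0 addr0.
  have bn : b != 0 by rewrite gt_eqF.
  have -> : 2 * ((x ^+ 2 + 1) / (2 * b)) * b = x ^+ 2 + 1 by field.
  by rewrite opprD addrA subrr add0r oppr_ge0 ler10.
(* The minimiser of the quadratic polynomial. *)
have := H (b / y ^+ 2).
have -> : x ^+ 2 - 2 * (b / y ^+ 2) * b + (b / y ^+ 2) ^+ 2 * y ^+ 2 =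
  x ^+ 2 - b ^+ 2 / y ^+ 2 by field.
rewrite subr_ge0 ler_pdivrMr ?exprn_even_gt0// -exprMn => bxy.
apply: le_trans (ler_norm b) _.
by rewrite -ler_sqr ?nnegrE ?mulr_ge0// real_normK ?num_real.
Qed.

Lemma nrm_triangle f g : L2 f -> L2 g ->
  nrm (fun z => f z + g z) <= nrm f + nrm g.
Proof.
move=> f2 g2; rewrite -ler_sqr ?nnegrE ?addr_ge0 ?nrm_ge0//.
rewrite nrm_sqr nrm2D// sqrrD !nrm_sqr lerD2r lerD2l mulr_natl lerMn2r/=.
exact: CauchySchwarz_Re.
Qed.

(** Right multiplication by E_ij moves column i to position j and erases all the others. *)
Lemma nrm_Mr_delta g i j : L2 g -> nrm (fun z => g z *m delta_mx i j) <= nrm g.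
Proof.
move=> g2; rewrite ler_sqrt ?nrm2_ge0// nrm2.unlock; apply: le_Rintegral => //.
- exact/L2_integrable/L2Mr.
- exact: L2_integrable.
move=> z _; rewrite [leRHS]hsnorm_col [leRHS](bigD1 i)//= hsnorm_col (bigD1 j)//=.
rewrite [X in _ + X]big1 => [|k kj].
  rewrite addr0 !colE -mulmxA mul_delta_mx lerDl.
  by apply: sumr_ge0 => k _; rewrite sqr_ge0.
by rewrite colE -mulmxA mul_delta_mx_0 1?eq_sym// mulmx0 hsnorm0 expr0n.
Qed.

Lemma gram_entry_Re f g i j : L2 f -> L2 g ->
  `|complex.Re (gram f g i j)| <= nrm f * nrm g.
Proof.
move=> f2 g2.
have H f' : L2 f' -> complex.Re (gram f' g i j) <= nrm f' * nrm g.
  move=> f2'; rewrite gram_entry//; have gd := L2Mr (delta_mx i j) g2.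
  apply: le_trans (CauchySchwarz_Re f2' gd) _.
  by rewrite ler_wpM2l ?nrm_ge0// nrm_Mr_delta.
rewrite ler_norml H// andbT; have := H _ (L2N f2).
by rewrite nrmN gramNl// mxE ReN lerNl.
Qed.

(** The bound on real parts applied to i f, since Re (i w) = - Im w and i f has the norm of f. *)
Lemma gram_entry_Im f g i j : L2 f -> L2 g ->
  `|complex.Im (gram f g i j)| <= nrm f * nrm g.
Proof.
move=> f2 g2; have := gram_entry_Re i j (L2Zc 'i%C f2) g2.
rewrite gramZl// mxE ReM/= mul0r mul1r sub0r normrN /nrm nrm2Z//.
by rewrite /sqmod/= expr0n expr1n add0r mul1r.
Qed.

(** Cauchy-Schwarz for the matrix-valued product. The crude constant counts a real and an imaginary
    part for each of the N^2 entries. *)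
Lemma hsnorm_gram f g : L2 f -> L2 g ->
  hsnorm (gram f g) <= (N ^ 2 * 2)%:R * (nrm f * nrm g).
Proof.
move=> f2 g2; apply: le_trans (hsnorm_le_sum _) _.
rewrite natrM expnS expn1 natrM -!mulrA [leRHS]mulr_natl -[X in _ *+ X]card_ord.
rewrite -sumr_const; apply: ler_sum => i _.
rewrite [leRHS]mulr_natl -[X in _ *+ X]card_ord -sumr_const; apply: ler_sum => j _.
by rewrite mulr_natl mulr2n lerD ?gram_entry_Re ?gram_entry_Im.
Qed.

Lemma nrm_bounded_mul (D : T -> M) (k : R) f : measurable_mx D -> L2 f -> 0 <= k ->
  {ae m, forall z, opnorm (D z) <= k} -> nrm (fun z => D z *m f z) <= k * nrm f.
Proof.
move=> mD f2 k0 Dk; have Df := L2M_bounded mD f2 Dk.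
rewrite -ler_sqr ?nnegrE ?mulr_ge0 ?nrm_ge0// exprMn !nrm_sqr nrm2.unlock.
rewrite -RintegralZl//; last exact: L2_integrable.
apply: ae_le_Rintegral; [exact: L2_integrable|exact/rintegrableZ/L2_integrable|].
apply: filterS Dk => z Dz; rewrite sqr_ge0/= -exprMn.
rewrite ler_sqr ?nnegrE ?mulr_ge0 ?hsnorm_ge0//.
by apply: le_trans (hsnorm_opnorm _ _) _; rewrite ler_wpM2r ?hsnorm_ge0.
Qed.

Lemma nrm_ae f g : L2 f -> L2 g -> {ae m, forall z, f z = g z} -> nrm f = nrm g.
Proof.
move=> f2 g2 fg; congr Num.sqrt; rewrite nrm2.unlock; apply: ae_eq_Rintegral.
- exact: measurable_hsnorm_sqr (L2_measurable f2).
- exact: measurable_hsnorm_sqr (L2_measurable g2).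
- by apply: filterS fg => z ->.
Qed.

Lemma nrm2_eq0 f : L2 f -> nrm2 f = 0 -> {ae m, forall z, f z = 0}.
Proof.
rewrite nrm2.unlock => f2 f0; have fi := L2_integrable f2.
have : (\int[m]_z `|(hsnorm (f z) ^+ 2)%:E|)%E = 0%E.
  under eq_integral do rewrite gee0_abs ?lee_fin ?sqr_ge0//.
  by rewrite -[LHS]fineK ?[fine _]f0//; exact: integrable_fin_num.
move=> /ae_eq_integral_abs H; have := H measurableT.
move=> /(_ (measurable_int _ fi)); apply: filterS => z /(_ I)/= -[].
by move=> /eqP; rewrite sqrf_eq0 => /eqP/hsnorm_eq0.
Qed.

End Gram.

(** * Completeness of the space of square integrable matrix functions *)

Section Completeness.
Variables (R : realType) (N : nat).
Local Notation T := (circle R).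
Local Notation m := (@circle_measure R).
Local Notation M := 'M[R[i]]_N.

Lemma cvgr_sum (I : Type) (r : seq I) (a : I -> R^nat) (l : I -> R) :
  (forall i, a i k @[k --> \oo] --> l i) ->
  \sum_(i <- r) a i k @[k --> \oo] --> \sum_(i <- r) l i.
Proof.
move=> al; elim: r => [|i r IH].
  by rewrite big_nil; under eq_fun do rewrite big_nil; exact: cvg_cst.
by rewrite big_cons; under eq_fun do rewrite big_cons; exact: cvgD.
Qed.

Lemma cvgr_sqr (a : R^nat) (l : R) :
  a k @[k --> \oo] --> l -> a k ^+ 2 @[k --> \oo] --> l ^+ 2.
Proof. by move=> al; rewrite expr2; under eq_fun do rewrite expr2; exact: cvgM. Qed.

Lemma cvgr_EFin (a : R^nat) (l : R) :
  a k @[k --> \oo] --> l -> (a k)%:E @[k --> \oo] --> l%:E.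
Proof. by move=> al; apply/fine_cvgP; split => //; exact: nearW. Qed.

Lemma cvg_summable_increments (a d : R^nat) :
  (forall k, `|a k.+1 - a k| <= d k) -> cvgn (series d) -> cvgn a.
Proof.
move=> ad cd; have ct : cvgn (series (telescope a)).
  apply: normed_cvg; apply: series_le_cvg cd => k; first exact: normr_ge0.
  - exact: le_trans (normr_ge0 _) (ad k).
  - exact: ad.
rewrite (_ : a = (fun k => a 0%N + series (telescope a) k)).
  by apply: is_cvgD => //; exact: is_cvg_cst.
by apply/funext => k; exact: eq_sum_telescope.
Qed.

(** Sum and integral commute for nonnegative terms, so the pointwise sum has a finite integral and
    is therefore finite almost everywhere. *)
Lemma ae_summable (d : nat -> T -> R) (c : R^nat) :
  (forall k z, 0 <= d k z) -> (forall k, rintegrable (d k)) ->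
  (forall k, \int[m]_z d k z <= c k) -> cvgn (series c) ->
  {ae m, forall z, cvgn (series (d^~ z))}.
Proof.
move=> d0 di dc cc.
have mdE k : measurable_fun setT (fun z => (d k z)%:E).
  exact/measurable_EFinP/rintegrable_measurable.
have dE0 k z : setT z -> (0 <= (d k z)%:E)%E by rewrite lee_fin.
have c0 k : 0 <= c k by apply: le_trans (dc k); exact: Rintegral_ge0.
have : m.-integrable setT (fun z => \sum_(0 <= k <oo) (d k z)%:E)%E.
  apply/integrableP; split.
    by apply: (@ge0_emeasurable_sum _ _ _ _ _ xpredT) => k; [move=> z _ _; exact: dE0|].
  under eq_integral => z _.
    rewrite gee0_abs; first over.
    by apply: nneseries_ge0 => k _ _; exact: dE0.
  rewrite integral_nneseries//.
  apply: (@le_lt_trans _ _ (\sum_(0 <= k <oo) (c k)%:E)%E).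
    apply: lee_nneseries => k _; first by move=> _; apply: integral_ge0; exact: dE0.
    by rewrite EFin_Rintegral// lee_fin.
  have -> : (\sum_(0 <= k <oo) (c k)%:E = (limn (series c))%:E)%E.
    rewrite -EFin_lim//; congr (limn _); apply/funext => n /=.
    by rewrite sumEFin.
  by rewrite ltry.
move=> /(integrable_ae measurableT); apply: filterS => z /(_ I) fz.
apply: nondecreasing_is_cvgn.
  exact: nondecreasing_series.
exists (fine (\sum_(0 <= k <oo) (d k z)%:E)%E) => _ [n _ <-].
rewrite -lee_fin fineK// -sumEFin.
by apply: nneseries_lim_ge => k _ _; rewrite lee_fin.
Qed.

(* A subsequence with [nrm2] of its increments at most [w k ^+ 2] has increments of
   integral at most [w k] (arithmetic-geometric mean), hence converges almost
   everywhere; Fatou's lemma then bounds the distance to the pointwise limit. *)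
Lemma L2_complete (f : nat -> T -> M) : (forall n, L2 (f n)) ->
  (forall e : R, 0 < e -> exists n0, forall p q, (n0 <= p)%N -> (n0 <= q)%N ->
    nrm2 (fun z => f p z - f q z) <= e) ->
  exists2 g, L2 g & forall e : R, 0 < e -> exists n0, forall n, (n0 <= n)%N ->
    nrm2 (fun z => g z - f n z) <= e.
Proof.
move=> f2 cf; have [w [w0 cw]] : exists w : R^nat, (forall k, 0 < w k) /\ cvgn (series w).
  exists (geometric 1 2^-1); split=> [k|]; first by rewrite /= mulr_gt0 ?exprn_gt0 ?invr_gt0.
  by apply: is_cvg_geometric_series; rewrite ger0_norm ?invr_ge0// invf_lt1// ltr1n.
have /choice[n0 n0P] k : exists n0, forall p q, (n0 <= p)%N -> (n0 <= q)%N ->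
    nrm2 (fun z => f p z - f q z) <= w k ^+ 2.
  by apply: cf; rewrite exprn_gt0.
pose phi k := (\max_(j < k.+1) n0 j)%N.
have phi_ge k j : (j <= k)%N -> (n0 j <= phi k)%N.
  by move=> jk; exact: (leq_bigmax (Ordinal (jk : (j < k.+1)%N))).
pose d k z := hsnorm (f (phi k.+1) z - f (phi k) z).
have di k : rintegrable (fun z => d k z ^+ 2) by apply/L2_integrable/L2B.
have dle k z : d k z <= 2^-1 * ((w k)^-1 * d k z ^+ 2 + w k).
  have wn : w k != 0 by rewrite gt_eqF.
  rewrite -subr_ge0.
  have -> : 2^-1 * ((w k)^-1 * d k z ^+ 2 + w k) - d k z =
    2^-1 * ((w k)^-1 * (d k z - w k) ^+ 2) by field.
  by rewrite mulr_ge0 ?invr_ge0// mulr_ge0 ?sqr_ge0// invr_ge0 ltW.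
have dbi k : rintegrable (fun z => 2^-1 * ((w k)^-1 * d k z ^+ 2 + w k)).
  by apply/rintegrableZ/rintegrableD; [exact: rintegrableZ|exact: rintegrable_cst].
have di1 k : rintegrable (d k).
  apply: rintegrable_le (dbi k) _.
    by apply: measurable_hsnorm; apply: L2_measurable; exact: L2B.
  by apply: aeW => z; rewrite ger0_norm ?hsnorm_ge0.
have int_d k : \int[m]_z d k z <= w k.
  apply: le_trans (le_Rintegral _ (di1 k) (dbi k) _) _ => //.
  rewrite RintegralZl//; last first.
    by apply/rintegrableD; [exact: rintegrableZ|exact: rintegrable_cst].
  rewrite RintegralD//; [|exact: rintegrableZ|exact: rintegrable_cst].
  rewrite (_ : \int[m]_z (w k) = w k); last exact: Rintegral_circle_cst.
  rewrite RintegralZl//; last exact: di.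
  have := n0P k (phi k.+1) (phi k) (phi_ge _ _ (leqnSn k)) (phi_ge _ _ (leqnn k)).
  rewrite nrm2.unlock => H.
  have : (w k)^-1 * \int[m]_z (d k z ^+ 2) <= (w k)^-1 * w k ^+ 2.
    by rewrite ler_wpM2l// invr_ge0 ltW.
  rewrite expr2 mulrA mulVf ?gt_eqF// mul1r; lra.
have ae_d := ae_summable (fun k z => hsnorm_ge0 _) di1 int_d cw.
(* The limit is written as the real part of an upper limit, which is defined and measurable on the
   whole circle, including where the subsequence diverges. *)
pose lr (b : M -> R) z : R := fine (limn_esup (fun k => (b (f (phi k) z))%:E)).
pose g : T -> M := fun z => \matrix_(i, j)
  (lr (fun A => complex.Re (A i j)) z +i* lr (fun A => complex.Im (A i j)) z).
have mlr b : (forall n, measurable_fun setT (fun z => b (f n z))) ->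
    measurable_fun setT (lr b).
  move=> mb; apply: measurableT_comp; first exact: fine_measurable.
  by apply: measurable_fun_limn_esup => k; exact/measurable_EFinP.
have mg : measurable_mx g.
  move=> i j; split; under eq_fun do rewrite mxE /=.
  - by apply: mlr => n; have [] := L2_measurable (f2 n) i j.
  - by apply: mlr => n; have [] := L2_measurable (f2 n) i j.
have lrP z (b : M -> R) : cvgn (series (d^~ z)) ->
    (forall A B, b A - b B = b (A - B)) -> (forall A, `|b A| <= hsnorm A) ->
    b (f (phi k) z) @[k --> \oo] --> lr b z.
  move=> cd bB bA; have cb : cvgn (fun k => b (f (phi k) z)).
    by apply: cvg_summable_increments cd => k; rewrite bB.
  by rewrite /lr (cvg_limn_einf_sup (cvgr_EFin cb)).2.
have fg z n : cvgn (series (d^~ z)) ->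
    (hsnorm (f (phi k) z - f n z) ^+ 2 @[k --> \oo] --> hsnorm (g z - f n z) ^+ 2).
  move=> cd; rewrite hsnorm_sqr; under eq_fun do rewrite hsnorm_sqr.
  apply: cvgr_sum => i; apply: cvgr_sum => j.
  rewrite /sqmod; under eq_fun do rewrite !mxE ReD ImD ReN ImN.
  rewrite !mxE ReD ImD ReN ImN /=.
  apply: cvgD; apply: cvgr_sqr; (apply: cvgB; last exact: cvg_cst); apply: lrP => //.
  - by move=> A B; rewrite !mxE ReD ReN.
  - by move=> A; exact: normRe_le_hsnorm.
  - by move=> A B; rewrite !mxE ImD ImN.
  - by move=> A; exact: normIm_le_hsnorm.
have ge n K : (n0 K <= n)%N ->
    (\int[m]_z (hsnorm (g z - f n z) ^+ 2)%:E <= (w K ^+ 2)%:E)%E.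
  move=> Kn; have mgf : measurable_mx (fun z => g z - f n z).
    by apply: measurable_mxB => //; exact: L2_measurable.
  (* Shifting by [K] puts every index past the threshold [n0 K], so that all the integrals under
     Fatou's lemma are at most [w K ^+ 2]; the pointwise limit is unaffected. *)
  pose h k z := (hsnorm (f (phi (k + K)%N) z - f n z) ^+ 2)%:E.
  have hi k : rintegrable (fun z => hsnorm (f (phi (k + K)%N) z - f n z) ^+ 2).
    by apply/L2_integrable/L2B.
  have mh k : measurable_fun setT (h k) by exact/measurable_EFinP/rintegrable_measurable.
  rewrite (_ : (\int[m]_z _)%E = (\int[m]_z limn_einf (h^~ z))%E); last first.
    apply: ae_eq_integral => //.
    - exact/measurable_EFinP/measurable_hsnorm_sqr.
    - rewrite /limn_einf; apply: measurableT_comp => //.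
      by apply: measurable_fun_limn_esup => k; exact: measurableT_comp.
    - apply: filterS ae_d => z cd _ /=; apply/esym.
      have /cvg_limn_einf_sup[//] : h k z @[k --> \oo] --> (hsnorm (g z - f n z) ^+ 2)%:E.
      apply: cvgr_EFin.
      by have := fg z n cd; rewrite -(cvg_shiftn K).
  apply: le_trans (fatou _ _ mh _) _ => //.
    by move=> k z _; rewrite lee_fin sqr_ge0.
  rewrite limn_einf_lim; apply: lime_le; first exact: is_cvg_einfs.
  near=> k; apply: le_trans (ereal_inf_lbound _) _; first by exists k => /=.
  rewrite EFin_Rintegral// lee_fin.
  have := n0P K (phi (k + K)%N) n (phi_ge _ _ (leq_addl _ _)) Kn.
  by rewrite nrm2.unlock.
have g2 : L2 g.
  have /L2D/(_ (f2 (n0 0%N))) : L2 (fun z => g z - f (n0 0%N) z).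
    apply/L2P; split.
      by apply: measurable_mxB => //; exact: L2_measurable.
    apply/integrableP; split.
      apply/measurable_EFinP/measurable_hsnorm_sqr/measurable_mxB => //.
      exact: L2_measurable.
    under eq_integral do rewrite gee0_abs ?lee_fin ?sqr_ge0//.
    exact: le_lt_trans (ge _ 0%N (leqnn _)) (ltry _).
  by under eq_fun do rewrite subrK.
exists g => // e e0.
have [K we] : exists K, w K ^+ 2 <= e.
  have wc := cvgr_sqr (cvg_series_cvg_0 cw).
  rewrite expr0n/= in wc; have /cvgrPdist_le/(_ e e0)[K _ HK] := wc.
  exists K; have := HK K (leqnn K).
  by rewrite /= sub0r normrN ger0_norm// sqr_ge0.
exists (n0 K) => n Kn; apply: le_trans we.
have gi : rintegrable (fun z => hsnorm (g z - f n z) ^+ 2) by apply/L2_integrable/L2B.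
by rewrite nrm2.unlock -lee_fin -EFin_Rintegral//; exact: ge.
Unshelve. all: by end_near.
Qed.

End Completeness.

(** * Uniqueness of Fourier coefficients *)

Section Uniqueness.
Variable R : realType.
Local Notation T := (circle R).
Local Notation m := (@circle_measure R).
Local Notation C := R[i].
Implicit Types (s w : T -> R).

Definition bounded_measurable s :=
  measurable_fun setT s /\ exists K : R, forall z, `|s z| <= K.

Lemma bounded_measurable_cst k : bounded_measurable (fun=> k).
Proof. by split; [exact: measurable_cst|exists `|k|]. Qed.

Lemma bounded_measurableD s w : bounded_measurable s -> bounded_measurable w ->
  bounded_measurable (fun z => s z + w z).
Proof.
move=> [ms [K sK]] [mw [L wL]]; split; first exact: measurable_funD.
by exists (K + L) => z; apply: le_trans (ler_normD _ _) _; exact: lerD.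
Qed.

Lemma bounded_measurableM s w : bounded_measurable s -> bounded_measurable w ->
  bounded_measurable (fun z => s z * w z).
Proof.
move=> [ms [K sK]] [mw [L wL]]; split; first exact: measurable_funM.
by exists (K * L) => z; rewrite normrM ler_pM.
Qed.

Lemma bounded_measurableX s n : bounded_measurable s ->
  bounded_measurable (fun z => s z ^+ n).
Proof.
move=> bs; elim: n => [|n IH]; first exact: bounded_measurable_cst.
by under eq_fun do rewrite exprS; exact: bounded_measurableM.
Qed.

Lemma normRe_circle (z : T) : `|complex.Re (sval z)| <= 1.
Proof.
case: z => z /= /eqP z1; have := normc_ge_Re z; rewrite z1.
by rewrite -[1 : C]/(1%:C) lecR.
Qed.

Lemma bounded_measurable_Re : bounded_measurable (fun z => complex.Re (sval z)).
Proof.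
by split; [have [] := cmeasurable_sval R|exists 1; exact: normRe_circle].
Qed.

Lemma normIm_circle (z : T) : `|complex.Im (sval z)| <= 1.
Proof.
case: z => z /= /eqP z1; have := normc_ge_Re (z * 'i%C).
rewrite ReiNIm normrN normrM z1 normc_def/= expr0n expr1n add0r sqrtr1 mulr1.
by rewrite -[1 : C]/(1%:C) lecR.
Qed.

Lemma bounded_measurable_Im : bounded_measurable (fun z => complex.Im (sval z)).
Proof.
by split; [have [] := cmeasurable_sval R|exists 1; exact: normIm_circle].
Qed.

Lemma rintegrable_bounded_mul s v : bounded_measurable s -> rintegrable v ->
  rintegrable (fun z => s z * v z).
Proof.
move=> [ms [K sK]] iv; have mv := rintegrable_measurable iv.
apply: rintegrable_le (rintegrableZ K (integrable_norm iv)) _.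
  exact: measurable_funM.
by apply: aeW => z; rewrite normrM /= ler_wpM2r.
Qed.

(* Iterating [smoothstep] pushes [0, 1/2[ to 0 and ]1/2, 1] to 1. *)
Definition smoothstep (t : R) : R := t ^+ 2 * (3 - 2 * t).

Lemma smoothstep01 t : 0 <= t <= 1 -> 0 <= smoothstep t <= 1.
Proof.
move=> /andP[t0 t1]; apply/andP; split.
  by rewrite mulr_ge0 ?sqr_ge0//; lra.
rewrite -subr_ge0 (_ : _ - _ = (1 - t) ^+ 2 * (1 + 2 * t)); last by rewrite /smoothstep; ring.
by rewrite mulr_ge0 ?sqr_ge0//; lra.
Qed.

Lemma iter_smoothstep01 t n : 0 <= t <= 1 -> 0 <= iter n smoothstep t <= 1.
Proof. by move=> t01; elim: n => //= n; exact: smoothstep01. Qed.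

(** One step multiplies u by u (3 - 2 u), which for u <= t < 1/2 is at most c = t (3 - 2 t); and c <
    1 because 1 - c = (1 - t) (1 - 2 t). The iterates decay at least like c^n. *)
Lemma iter_smoothstep_lt t : 0 <= t < 2^-1 ->
  iter n smoothstep t @[n --> \oo] --> (0 : R).
Proof.
move=> /andP[t0 t1]; pose c := t * (3 - 2 * t).
have c1 : c < 1.
  rewrite -subr_gt0 (_ : _ - _ = (1 - t) * (1 - 2 * t)); last by rewrite /c; ring.
  by rewrite mulr_gt0; lra.
have c0 : 0 <= c by rewrite mulr_ge0//; lra.
have H n : 0 <= iter n smoothstep t <= c ^+ n * t.
  elim: n => [|n /andP[u0 un]]; first by rewrite /= expr0 mul1r t0 lexx.
  have cn1 : c ^+ n <= 1 by rewrite exprn_ile1// ltW.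
  rewrite iterS; move: u0 un; set u := iter n _ _ => u0 un.
  have ut : u <= t by apply: le_trans un _; rewrite ler_piMl.
  have uc : u * (3 - 2 * u) <= c.
    rewrite -subr_ge0 (_ : _ - _ = (t - u) * (3 - 2 * (t + u))); last by rewrite /c; ring.
    by rewrite mulr_ge0//; lra.
  rewrite {1}/smoothstep mulr_ge0 ?sqr_ge0//=; last lra.
  rewrite exprS -mulrA /smoothstep expr2 -mulrA mulrC.
  by apply: ler_pM => //; rewrite mulr_ge0//; lra.
apply: (@squeeze_cvgr _ _ _ _ (fun=> 0) (fun n => c ^+ n * t)).
- by apply: nearW => n; exact: H.
- exact: cvg_cst.
- rewrite -(mul0r t); apply: cvgM; last exact: cvg_cst.
  by apply: cvg_expr; rewrite ger0_norm.
Qed.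

(** This symmetry about 1/2 transfers the decay on the left half of the interval to convergence to 1
    on the right half. *)
Lemma iter_smoothstep_sym t n :
  iter n smoothstep (1 - t) = 1 - iter n smoothstep t.
Proof. by elim: n => //= n ->; rewrite /smoothstep; ring. Qed.

Lemma iter_smoothstep_cvg t : 0 <= t <= 1 ->
  iter n smoothstep t @[n --> \oo] -->
    (if t < 2^-1 then 0 else if t == 2^-1 then 2^-1 else 1 : R).
Proof.
move=> /andP[t0 t1]; have [tlt|tgt|->] := ltgtP t 2^-1.
- by apply: iter_smoothstep_lt; rewrite t0.
- have -> : (fun n => iter n smoothstep t) = (fun n => 1 - iter n smoothstep (1 - t)).
    by apply/funext => n; rewrite iter_smoothstep_sym subKr.
  rewrite -[X in _ --> X]subr0; apply: cvgB; first exact: cvg_cst.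
  by apply: iter_smoothstep_lt; apply/andP; split; lra.
- have -> : (fun n => iter n smoothstep 2^-1) = fun=> 2^-1; last exact: cvg_cst.
  by apply/funext; elim=> //= n ->; rewrite /smoothstep; field.
Qed.

Section Multipliers.
Variable v : T -> R.
Hypothesis iv : rintegrable v.

(* If [v] annihilates all the monomials in [Re z] and [Im z], then [1] is in
   [annihilates]. The multipliers of this class form an algebra containing [Re z]
   and [Im z] and closed under bounded pointwise limits, so they contain the
   indicators of all the measurable sets, and [v] integrates to 0 over each. *)
Definition annihilates w := forall j k : nat,
  \int[m]_z (complex.Re (sval z) ^+ j * complex.Im (sval z) ^+ k * w z * v z) = 0.

Definition multiplier s := bounded_measurable s /\ forall w,
  bounded_measurable w -> annihilates w -> annihilates (fun z => s z * w z).

Lemma bounded_measurable_mono j k w : bounded_measurable w ->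
  bounded_measurable (fun z : T =>
    complex.Re (sval z) ^+ j * complex.Im (sval z) ^+ k * w z).
Proof.
move=> bw; apply: bounded_measurableM => //; apply: bounded_measurableM.
- exact/bounded_measurableX/bounded_measurable_Re.
- exact/bounded_measurableX/bounded_measurable_Im.
Qed.

Lemma rintegrable_mono j k w : bounded_measurable w ->
  rintegrable (fun z : T =>
    complex.Re (sval z) ^+ j * complex.Im (sval z) ^+ k * w z * v z).
Proof.
by move=> bw; apply: rintegrable_bounded_mul => //; exact: bounded_measurable_mono.
Qed.

Lemma multiplier_Re : multiplier (fun z => complex.Re (sval z)).
Proof.
split; first exact: bounded_measurable_Re.
move=> w bw aw j k; rewrite -[RHS](aw j.+1 k); apply: eq_Rintegral => z _.
by rewrite exprS; ring.
Qed.

Lemma multiplier_Im : multiplier (fun z => complex.Im (sval z)).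
Proof.
split; first exact: bounded_measurable_Im.
move=> w bw aw j k; rewrite -[RHS](aw j k.+1); apply: eq_Rintegral => z _.
by rewrite exprS; ring.
Qed.

Lemma multiplier_cst k : multiplier (fun=> k).
Proof.
split; first exact: bounded_measurable_cst.
move=> w bw aw i j; under eq_Rintegral do rewrite mulrCA -mulrA.
by rewrite RintegralZl ?aw ?mulr0//; exact: rintegrable_mono.
Qed.

Lemma multiplierD s t : multiplier s -> multiplier t ->
  multiplier (fun z => s z + t z).
Proof.
move=> [bs ms] [bt mt]; split; first exact: bounded_measurableD.
move=> w bw aw j k; under eq_Rintegral do rewrite mulrDl mulrDr mulrDl.
by rewrite RintegralD ?ms ?mt ?addr0//;
  apply: rintegrable_mono; exact: bounded_measurableM.
Qed.

Lemma multiplierM s t : multiplier s -> multiplier t ->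
  multiplier (fun z => s z * t z).
Proof.
move=> [bs ms] [bt mt]; split; first exact: bounded_measurableM.
move=> w bw aw; under eq_fun do rewrite -mulrA.
apply: ms; last exact: mt.
exact: bounded_measurableM.
Qed.

Lemma multiplierX s n : multiplier s -> multiplier (fun z => s z ^+ n).
Proof.
move=> ms; elim: n => [|n IH]; first exact: multiplier_cst.
by under eq_fun do rewrite exprS; exact: multiplierM.
Qed.

(** Dominated convergence: each moment integrand is bounded by [K] times the one without the
    multiplier, which is integrable. *)
Lemma multiplier_lim (s : nat -> T -> R) (t : T -> R) (K : R) :
  (forall n, multiplier (s n)) -> (forall n z, `|s n z| <= K) ->
  (forall z, s n z @[n --> \oo] --> t z) -> multiplier t.
Proof.
move=> ms sK st; have mt : measurable_fun setT t.
  apply: (@measurable_fun_cvg _ _ _ _ s) => [n|z _]; last exact: st.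
  by have [[]] := ms n.
have tK z : `|t z| <= K.
  have cn : `|s n z| @[n --> \oo] --> `|t z| by apply: cvg_norm; exact: st.
  rewrite -(cvg_lim (@Rhausdorff R) cn).
  by apply: limr_le; [apply/cvg_ex; exists `|t z|; exact: cn|exact: nearW].
have bt : bounded_measurable t by split=> //; exists K.
split => // w bw aw j k.
pose p n (z : T) := complex.Re (sval z) ^+ j * complex.Im (sval z) ^+ k * (s n z * w z) * v z.
pose q (z : T) := complex.Re (sval z) ^+ j * complex.Im (sval z) ^+ k * (t z * w z) * v z.
have ip n : rintegrable (p n).
  by apply/rintegrable_mono/bounded_measurableM => //; have [] := ms n.
have iq : rintegrable q by apply/rintegrable_mono/bounded_measurableM.
pose b (z : T) := K * `|complex.Re (sval z) ^+ j * complex.Im (sval z) ^+ k * w z * v z|.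
have ib : rintegrable b by apply/rintegrableZ/integrable_norm/rintegrable_mono.
have pq z : p n z @[n --> \oo] --> q z.
  by apply: cvgM; [apply: cvgM; [exact: cvg_cst|apply: cvgM; [exact: st|exact: cvg_cst]]
    |exact: cvg_cst].
have aepq : {ae m, forall z, setT z ->
    (EFin \o p n) z @[n --> \oo] --> (EFin \o q) z}.
  by apply: aeW => z _; apply: cvgr_EFin; exact: pq.
have H z : forall n, setT z -> (`|(EFin \o p n) z| <= (EFin \o b) z)%E.
  move=> n _; rewrite /= lee_fin /p /b !normrM.
  have := sK n z; set x := `|s n z|; set K1 := `|complex.Re (sval z) ^+ j|.
  set K2 := `|_|; set K3 := `|w z|; set K4 := `|v z| => xK.
  have -> : K1 * K2 * (x * K3) * K4 = x * (K1 * K2 * K3 * K4) by ring.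
  by rewrite ler_wpM2r// /K1 /K2 /K3 /K4 -!normrM.
have [_ _] := dominated_convergence measurableT (fun n => measurable_int _ (ip n))
  (measurable_int _ iq) aepq ib (aeW _ H).
rewrite (_ : [sequence _]_n = fun=> 0%:E); last first.
  by apply/funext => n /=; rewrite EFin_Rintegral// (ms n).2.
move=> /(cvg_unique (@ereal_hausdorff R) (cvg_cst _)).
by rewrite EFin_Rintegral// => -[].
Qed.

(** Iterating [smoothstep] on [t] stays within polynomials in [t] and converges boundedly to a step
    function, which however takes the value 1/2 on the level set t = 1/2. *)
Lemma multiplier_half_step t : multiplier t -> (forall z, 0 <= t z <= 1) ->
  multiplier (\1_[set z | 2^-1 < t z]).
Proof.
move=> mt t01; pose h z : R :=
  if t z < 2^-1 then 0 else if t z == 2^-1 then 2^-1 else 1.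
have mh : multiplier h.
  apply: (@multiplier_lim (fun n z => iter n smoothstep (t z)) _ 1).
  - elim=> [//|n IH] /=; rewrite /smoothstep; apply: multiplierM.
      exact: multiplierX.
    apply: multiplierD; first exact: multiplier_cst.
    under eq_fun do rewrite -mulNr.
    by apply: multiplierM => //; exact: multiplier_cst.
  - by move=> n z; have /andP[u0 u1] := iter_smoothstep01 n (t01 z); rewrite ger0_norm.
  - by move=> z; exact: iter_smoothstep_cvg.
have h01 z : 0 <= h z <= 1.
  rewrite /h; case: ltP => _; first by rewrite lexx ler01.
  by case: eqP => _; [apply/andP; split; lra|rewrite ler01 lexx].
(* Powers send the value 1/2 to 0 and fix 0 and 1, which leaves the indicator of the strict
   inequality. The exponent n + 1 avoids the power 0, which would be 1 where [h] vanishes. *)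
apply: (@multiplier_lim (fun n z => h z ^+ n.+1) _ 1).
- by move=> n; exact: multiplierX.
- move=> n z; have /andP[h0 h1] := h01 z.
  by rewrite ger0_norm ?exprn_ge0// exprn_ile1.
- move=> z; rewrite indicE; have [zt|tz|zt] := ltgtP (t z) 2^-1.
  + rewrite /h zt memNset; last by rewrite /= ltNge (ltW zt).
    by under eq_fun do rewrite expr0n/=; exact: cvg_cst.
  + rewrite /h ltNge (ltW tz) (gt_eqF tz)/= mem_set//.
    by under eq_fun do rewrite expr1n; exact: cvg_cst.
  + rewrite /h zt ltxx eqxx memNset; last by rewrite /= zt ltxx.
    have : (2^-1 : R) ^+ n @[n --> \oo] --> (0 : R).
      by apply: cvg_expr; rewrite ger0_norm ?invr_ge0// invf_lt1// ltr1n.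
    by rewrite -cvg_shiftS.
Qed.

Definition multiplier_set (A : set T) := multiplier (\1_A).

(** Complements and finite unions are polynomial in the indicators; a countable union is the bounded
    pointwise limit of its finite stages. *)
Lemma sigma_algebra_multiplier_set : sigma_algebra setT multiplier_set.
Proof.
have UE (A B : set T) : \1_(A `|` B) =
    (fun z => \1_A z + \1_B z + - 1 * (\1_A z * \1_B z)) :> (T -> R).
  apply/funext => z; rewrite !indicE in_setU.
  by case: (_ \in A); case: (_ \in B) => /=; ring.
have m0 : multiplier_set set0 by rewrite /multiplier_set indic0; exact: multiplier_cst.
split => //.
- move=> A mA; rewrite /multiplier_set.
  rewrite (_ : \1_(setT `\` A) = (fun z => 1 + - 1 * \1_A z) :> (T -> R)).
    by apply/multiplierD/multiplierM => //; exact: multiplier_cst.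
  by apply/funext => z; rewrite !indicE in_setD in_setT; case: (_ \in A) => /=; ring.
- move=> A mA; rewrite /multiplier_set.
  apply: (@multiplier_lim (fun n => \1_(\big[setU/set0]_(k < n) A k)) _ 1).
  + elim=> [|n IH]; first by rewrite big_ord0.
    rewrite big_ord_recr UE; apply: multiplierD; first exact: multiplierD IH (mA n).
    exact: multiplierM (multiplier_cst _) (multiplierM IH (mA n)).
  + by move=> n z; rewrite indicE; case: (_ \in _); rewrite /= ?normr1// normr0.
  + move=> z; rewrite !indicE; have [[n _ Anz]|NA] := pselect ((\bigcup_k A k) z).
      rewrite mem_set; last by exists n.
      apply: cvg_near_cst; exists n.+1 => // k /= nk.
      by rewrite indicE mem_set// -bigcup_mkord; exists n.
    rewrite memNset//; apply: cvg_near_cst; apply: nearW => k.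
    by rewrite indicE memNset// -bigcup_mkord => -[j _ Ajz]; apply: NA; exists j.
Qed.

(** The open half-lines ]a, +oo[ generate the Borel sets of the line, so it suffices to treat the
    sets f > a. *)
Lemma multiplier_set_preimage (f : T -> R) : multiplier f ->
  (forall z, `|f z| <= 1) -> forall B, measurable B -> multiplier_set (f @^-1` B).
Proof.
move=> mf f1 B; have [s0 sC sU] := sigma_algebra_multiplier_set.
rewrite [measurable]RGenOInfty.measurableE; move: B.
apply: (@smallest_sub _ (sigma_algebra setT) _
  [set B | multiplier_set (f @^-1` B)]); first split.
- by rewrite /= preimage_set0.
- by move=> A mA; rewrite /= setTD preimage_setC -setTD; exact: sC.
- by move=> A mA; rewrite /= preimage_bigcup; exact: sU.
move=> _ [a ->].
(* Since |f - a| <= 1 + |a|, this scale makes 1/2 + c (f - a) take values in [0, 1], and it exceeds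
   1/2 exactly where f > a. *)
pose c : R := (2 * (1 + `|a|))^-1.
have d0 : 0 < 2 * (1 + `|a|) by rewrite mulr_gt0// ltr_pwDl.
have c0 : 0 < c by rewrite invr_gt0.
pose t z := 2^-1 + c * (f z - a).
have t01 z : 0 <= t z <= 1.
  have : `|c * (f z - a)| <= 2^-1.
    rewrite normrM (gtr0_norm c0) mulrC ler_pdivrMr// mulrA mulVf// mul1r.
    by apply: le_trans (ler_normB _ _) _; rewrite lerD2r.
  rewrite ler_norml /t => /andP[? ?]; apply/andP; split; lra.
have mt : multiplier t.
  apply: multiplierD; first exact: multiplier_cst.
  apply: multiplierM; first exact: multiplier_cst.
  exact: multiplierD mf (multiplier_cst _).
have := multiplier_half_step mt t01; congr (multiplier (\1_ _)).
apply/seteqP; split => z /=.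
  by rewrite /t ltrDl pmulr_rgt0// subr_gt0 in_itv/= andbT.
by rewrite /t ltrDl pmulr_rgt0// subr_gt0 in_itv/= andbT.
Qed.

(** Measurable sets of the circle are traces of Borel sets of the plane, and these are generated by
    the preimages of Borel sets under the two coordinates. *)
Lemma multiplier_set_measurable (A : set T) : measurable A -> multiplier_set A.
Proof.
move=> [B mB <-]; rewrite setTI; have [s0 sC sU] := sigma_algebra_multiplier_set.
have fx : forall D : set R, measurable D ->
    multiplier_set ((fun z : T => complex.Re (sval z)) @^-1` D).
  exact: multiplier_set_preimage multiplier_Re normRe_circle.
have fy : forall D : set R, measurable D ->
    multiplier_set ((fun z : T => complex.Im (sval z)) @^-1` D).
  exact: multiplier_set_preimage multiplier_Im normIm_circle.
move: B mB; apply: (@smallest_sub _ (sigma_algebra setT) _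
  [set B | multiplier_set (@circle_coord R @^-1` B)]); first split.
- by rewrite /= preimage_set0.
- by move=> D mD; rewrite /= setTD preimage_setC -setTD; exact: sC.
- by move=> D mD; rewrite /= preimage_bigcup; exact: sU.
by move=> _ [[D mD <-]|[D mD <-]]; rewrite setTI; [exact: fx|exact: fy].
Qed.

(** The hypothesis says that 1 is in [annihilates]. Multiplying by the indicator of a measurable set
    and reading the moment j = k = 0 shows that [v] integrates to 0 over that set. *)
Lemma ae_eq0_of_moments :
  (forall j k,
    \int[m]_z (complex.Re (sval z) ^+ j * complex.Im (sval z) ^+ k * v z) = 0) ->
  {ae m, forall z, v z = 0}.
Proof.
move=> v0.
have a1 : annihilates (fun=> 1).
  by move=> j k; rewrite -[RHS](v0 j k); apply: eq_Rintegral => z _; rewrite mulr1.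
have H : ae_eq m setT (EFin \o v) (cst 0%E).
  apply: integral_ae_eq => // E _ mE; rewrite integral0.
  have [_ mEE] := multiplier_set_measurable mE.
  have := mEE _ (bounded_measurable_cst 1) a1 0%N 0%N.
  rewrite integral_mkcond => IE; rewrite -[RHS]/(0%:E) -IE -EFin_Rintegral.
    apply: eq_integral => z _; rewrite patchE indicE /=.
    by case: ifPn => _ /=; rewrite !expr0 ?mul0r ?mul1r ?mul0r// .
  apply: rintegrable_mono; apply: bounded_measurableM (bounded_measurable_cst 1).
  by have [] := multiplier_set_measurable mE.
by apply: filterS H => z /(_ I)[].
Qed.

End Multipliers.

Lemma cintegrable_shift (u : T -> C) (n : int) : cintegrable u ->
  cintegrable (fun z => (sval z ^ n)%R * u z).
Proof.
move=> iu; apply: cintegrable_le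
  (rintegrableD (integrable_norm iu.1) (integrable_norm iu.2)) _.
  exact: cmeasurableM (cmeasurable_exprz _ _) (cintegrable_measurable iu).
apply: aeW => z /=.
have : sqmod ((sval z ^ n)%R : C) = 1 by exact: sqmod_circle.
rewrite ReM ImM; set c := complex.Re (_ ^ _)%R; set d := complex.Im (_ ^ _)%R.
rewrite /sqmod -/c -/d => cd1.
have c1 : `|c| <= 1.
  by rewrite -(@ler_sqr _ `|c|) ?nnegrE// expr1n real_normK ?num_real// -cd1 lerDl sqr_ge0.
have d1 : `|d| <= 1.
  by rewrite -(@ler_sqr _ `|d|) ?nnegrE// expr1n real_normK ?num_real// -cd1 lerDr sqr_ge0.
split.
- by apply: le_trans (ler_normB _ _) _; rewrite !normrM lerD// ler_piMl.
- by apply: le_trans (ler_normD _ _) _; rewrite !normrM addrC lerD// ler_piMl.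
Qed.

(** On the circle Re z = (z + z^-1) / 2 and Im z = (z - z^-1) / (2 i), so every moment of [u] in the
    coordinates is a combination of its Fourier coefficients. The real and imaginary parts of [u]
    are then treated separately. *)
Lemma ae_eq0_of_fourier (u : T -> C) : cintegrable u ->
  (forall n : int, cintegral (fun z => (sval z ^ n)%R * u z) = 0) ->
  {ae m, forall z, u z = 0}.
Proof.
move=> iu u0.
pose X (z : T) := complex.Re (sval z); pose Y (z : T) := complex.Im (sval z).
have XE z (n : int) : (X z)%:C * (sval z ^ n)%R =
    2^-1 * (sval z ^ (n + 1))%R + 2^-1 * (sval z ^ (n - 1))%R.
  rewrite !expfzDr ?circle_neq0// expr1z exprN1 -circle_conj -mulrDr -mulrDr addcJ.
  rewrite -/(X z); move: (sval z ^ n)%R (X z)%:C => a b.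
  by rewrite [a * _]mulrCA mulKf ?pnatr_eq0// mulrC.
have YE z (n : int) : (Y z)%:C * (sval z ^ n)%R =
    - 'i%C / 2 * (sval z ^ (n + 1))%R + 'i%C / 2 * (sval z ^ (n - 1))%R.
  rewrite !expfzDr ?circle_neq0// expr1z exprN1 -circle_conj.
  have -> : (sval z)^*%C = sval z - 2 * (Y z)%:C * 'i%C by rewrite -subcJ subKr.
  have : 'i%C * 'i%C = -1 :> C by rewrite -expr2 sqr_i.
  move: (Y z)%:C (sval z) ('i%C : C) => b c i ii; move: (c ^ n)%R => a.
  transitivity (- (i * i) * (b * a)); first by rewrite ii opprK mul1r.
  by field.
pose W j k (n : int) z := (X z ^+ j * Y z ^+ k)%:C * ((sval z ^ n)%R * u z).
have comb (a b : C) (w w1 w2 : T -> C) : (forall z, w z = a * w1 z + b * w2 z) ->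
    cintegrable w1 /\ cintegral w1 = 0 -> cintegrable w2 /\ cintegral w2 = 0 ->
    cintegrable w /\ cintegral w = 0.
  move=> /funext -> [iw1 w10] [iw2 w20]; split.
    by apply: cintegrableD; exact: cintegrableZ.
  rewrite cintegralD; [|exact: cintegrableZ..].
  by rewrite !cintegralZ// w10 w20 !mulr0 addr0.
(* The exponent n must stay free in the induction, since removing one factor X or Y replaces it by n
   + 1 and n - 1. *)
have W0 j k n : cintegrable (W j k n) /\ cintegral (W j k n) = 0.
  elim: j n => [|j IH] n; last first.
    apply: (@comb 2^-1 2^-1 _ (W j k (n + 1)) (W j k (n - 1))) => // z.
    rewrite /W exprS -mulrA rmorphM/= -mulrA [_ * (_ * u z)]mulrCA !mulrA XE.
    by rewrite mulrDl; ring.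
  elim: k n => [|k IH] n; last first.
    apply: (@comb (- 'i%C / 2) ('i%C / 2) _ (W 0%N k (n + 1)) (W 0%N k (n - 1))) => // z.
    rewrite /W (_ : X z ^+ 0 * Y z ^+ k.+1 = Y z * (X z ^+ 0 * Y z ^+ k)).
      rewrite rmorphM/= -mulrA [_ * (_ * u z)]mulrCA !mulrA YE.
      by rewrite mulrDl; ring.
    by rewrite exprS mulrCA.
  rewrite (_ : W 0%N 0%N n = (fun z => (sval z ^ n)%R * u z)).
    by split; [exact: cintegrable_shift|exact: u0].
  by apply/funext => z; rewrite /W !expr0 mulr1 mul1r.
have re0 : {ae m, forall z, complex.Re (u z) = 0}.
  apply: (ae_eq0_of_moments iu.1) => j k.
  have [_ /(congr1 (@complex.Re R))/= <-] := W0 j k 0; apply: eq_Rintegral => z _.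
  by rewrite /W expr0z mul1r ReM/= mul0r subr0.
have im0 : {ae m, forall z, complex.Im (u z) = 0}.
  apply: (ae_eq0_of_moments iu.2) => j k.
  have [_ /(congr1 (@complex.Im R))/= <-] := W0 j k 0; apply: eq_Rintegral => z _.
  by rewrite /W expr0z mul1r ImM/= mul0r addr0.
by apply: filterS2 re0 im0 => z ur ui; exact: complexP.
Qed.

End Uniqueness.

(** * Fourier series *)

Section FourierBasis.
Variable R : realType.
Local Notation T := (circle R).
Local Notation m := (@circle_measure R).
Local Notation mu := (@lebesgue_measure R).

(** Change of variables along [expi]; [unit_lebesgue] gives measure 0 to the complement of [0, 1],
    which can then be removed. *)
Lemma Rintegral_circle (a : T -> R) : bounded_measurable a ->
  \int[m]_z a z = \int[mu]_(t in `[0, 1]) a (expi t).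
Proof.
move=> [ma [K aK]].
have mE := @measurable_expi R.
have uE A : @unit_lebesgue R A = mu (A `&` `[0, 1]) by [].
have mae : measurable_fun setT (a \o @expi R) by exact: measurableT_comp.
have iae : (@unit_lebesgue R).-integrable [set: measurableTypeR R] (EFin \o (a \o @expi R)).
  apply: measurable_bounded_integrable => //.
    by rewrite [X in (X < _)%E]uE setTI lebesgue_measure_itv/= lte01 oppr0 adde0 ltry.
  exists K; split; first exact: num_real.
  by move=> x Kx t _ /=; apply: le_trans (aK _) (ltW Kx).
congr fine.
rewrite (eq_measure_integral (pushforward (@unit_lebesgue R) (@expi R)))//.
rewrite integral_pushforward//; last exact/measurable_EFinP.
rewrite preimage_setT.
have m01 : measurable (~` [set` `[0, 1]] : set (measurableTypeR R)).
  exact: measurableC (@measurable_itv R `[0, 1]).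
have mu0 : @unit_lebesgue R (~` [set` `[0, 1]]) = 0%E by rewrite uE setICl measure0.
rewrite [LHS](negligible_integral m01 measurableT iae mu0).
rewrite setDE setCK setTI; apply: (eq_measure_integral mu) => A mA A01.
by rewrite [LHS]uE setIidl.
Qed.

(** Fundamental theorem of calculus: the primitives are multiples of sin (c t) and cos (c t), and
    take equal values at 0 and 1 because c is a multiple of 2 pi. *)
Lemma integral_cos_sin (n : nat) : (0 < n)%N ->
  \int[mu]_(t in `[0, 1]) cos (2 * pi * n%:R * t) = 0 /\
  \int[mu]_(t in `[0, 1]) sin (2 * pi * n%:R * t) = 0.
Proof.
move=> n0; set c : R := 2 * pi * n%:R.
have c0 : c != 0 by rewrite !mulf_neq0 ?gt_eqF ?pi_gt0 ?ltr0n.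
have per : sin c = 0 /\ cos c = 1.
  rewrite /c mulr_natr mulr_natl; elim: n {n0 c c0} => [|n [s1 c1]].
    by rewrite mulr0n sin0 cos0.
  move: (sin2pi R) (cos2pi R) s1 c1; rewrite [_ *+ n.+1]mulrS.
  move: (pi *+ 2) => a; move: (a *+ n) => b sa ca sb cb.
  by rewrite sinD cosD sa ca sb cb; split; ring.
have dlin (t : R) : is_derive t 1 ( *%R c) c.
  by apply: is_derive_eq; rewrite ?scaler0 ?add0r ?addr0; exact: mulr1.
have ds (t : R) : is_derive t 1 (fun t => c^-1 * sin (c * t)) (cos (c * t)).
  apply: (is_derive_eq (is_deriveZ c^-1 (is_derive1_comp (is_derive_sin (c * t)) (dlin t)))).
  by rewrite /GRing.scale/= mulrCA mulVf ?mulr1.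
have dc (t : R) : is_derive t 1 (fun t => - c^-1 * cos (c * t)) (sin (c * t)).
  apply: (is_derive_eq (is_deriveZ (- c^-1) (is_derive1_comp (is_derive_cos (c * t)) (dlin t)))).
  by rewrite /GRing.scale/= mulNr mulNr mulrN opprK mulrCA mulVf ?mulr1.
have main (F f : R -> R) : (forall t : R, is_derive t 1 F (f t)) -> continuous f ->
    F 0 = F 1 -> \int[mu]_(t in `[0, 1]) f t = 0.
  move=> dF cf F01; rewrite /Rintegral (@continuous_FTC2 _ f F)//.
  - by rewrite F01 subee.
  - exact: continuous_subspaceT.
  - have cF : continuous F.
      by move=> t; apply/differentiable_continuous/derivable1_diffP; case: (dF t).
    split; first by move=> t _; case: (dF t).
    + by apply: cvg_at_right_filter; exact: cF.
    + by apply: cvg_at_left_filter; exact: cF.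
  - by move=> t _; rewrite derive1E; case: (dF t).
have ct : continuous ( *%R c) by exact: mulrl_continuous.
split.
- apply: main ds _ _.
    by move=> t; apply: continuous_comp; [exact: ct|exact: continuous_cos].
  by rewrite mulr0 mulr1 sin0 per.1.
- apply: main dc _ _.
    by move=> t; apply: continuous_comp; [exact: ct|exact: continuous_sin].
  by rewrite mulr0 mulr1 cos0 per.2.
Qed.

Lemma expi_exp (t : R) n :
  sval (expi t) ^+ n = cos (2 * pi * n%:R * t) +i* sin (2 * pi * n%:R * t).
Proof.
elim: n => [|n IH]; first by rewrite expr0 mulr0 mul0r cos0 sin0.
rewrite exprS IH; apply: complexP; rewrite ?ReM ?ImM /=.
  by rewrite -cosD; congr cos; rewrite -natr1; ring.
by rewrite addrC -sinD; congr sin; rewrite -natr1; ring.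
Qed.

Lemma cintegral_exprz (n : int) : n != 0 ->
  cintegral (fun z : T => (sval z ^ n)%R) = 0.
Proof.
have H k : (0 < k)%N -> cintegral (fun z : T => sval z ^+ k) = 0.
  move=> k0; have [mr mi] := cmeasurable_exprz R k.
  have bs (z : T) : sqmod (sval z ^+ k) = 1 by exact: (sqmod_circle z k).
  have [ci si] := integral_cos_sin k0.
  apply: complexP => /=.
  - rewrite Rintegral_circle.
      by rewrite -[RHS]ci; apply: eq_Rintegral => t _; rewrite expi_exp.
    split=> //; exists 1 => z; rewrite -ler_sqr ?nnegrE// expr1n real_normK ?num_real//.
    by rewrite -(bs z) lerDl sqr_ge0.
  - rewrite Rintegral_circle.
      by rewrite -[RHS]si; apply: eq_Rintegral => t _; rewrite expi_exp.
    split=> //; exists 1 => z; rewrite -ler_sqr ?nnegrE// expr1n real_normK ?num_real//.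
    by rewrite -(bs z) lerDr sqr_ge0.
case: n => [[//|k]|k] _; first exact: H.
rewrite (_ : (fun z : T => _) = (fun z : T => (sval z ^+ k.+1)^*%C)).
  rewrite cintegralJ ?H ?rmorph0//.
  rewrite (_ : (fun z : T => _) = (fun z : T => (sval z ^ k.+1)%R * 1)).
    by apply: cintegrable_shift; split; exact: rintegrable_cst.
  by apply/funext => z; rewrite mulr1.
by apply/funext => z; rewrite [RHS](circle_conjXz z k.+1).
Qed.

End FourierBasis.

Section FourierSeries.
Variables (R : realType) (N : nat).
Local Notation T := (circle R).
Local Notation m := (@circle_measure R).
Local Notation C := R[i].
Local Notation M := 'M[C]_N.
Implicit Types (f g h : T -> M) (n : int) (r : seq int) (A B : M).

Definition monomial n A : T -> M := fun z => (sval z ^ n)%R *: A.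

Lemma L2_monomial n A : L2 (monomial n A).
Proof. exact/L2_shift/L2_cst. Qed.

Lemma mintegrable_L2 f : L2 f -> mintegrable f.
Proof.
move=> f2; have := mintegrable_L2M f2 (L2_cst 1%:M).
by under eq_fun do rewrite mul1mx.
Qed.

Lemma fourierE f n : fourier f n = mintegral (fun z => (sval z ^ (- n))%R *: f z).
Proof.
apply/matrixP => i j; rewrite !mxE; congr cintegral.
by apply/funext => z; rewrite mxE.
Qed.

Lemma gram_monomial f n A : L2 f -> gram f (monomial n A) = A^t* *m fourier f n.
Proof.
move=> f2; rewrite fourierE gramE -mintegralMl; last exact/mintegrable_L2/L2_shift.
congr mintegral; apply/funext => z.
by rewrite conjmxZ [X in X *: _ *m _]circle_conjXz -scalemxAl -scalemxAr.
Qed.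

Lemma fourier_gram f n : L2 f -> fourier f n = gram f (monomial n 1%:M).
Proof. by move=> f2; rewrite gram_monomial// conjmx_scalar conjC1 mul1mx. Qed.

Lemma fourier_monomial k A n : fourier (monomial k A) n = if n == k then A else 0.
Proof.
rewrite fourierE (_ : (fun z => _) = (fun z => (sval z ^ (k - n))%R *: A)).
  have [->|nk] := eqVneq n k.
    rewrite subrr -[RHS](mintegral_cst A); congr mintegral.
    by apply/funext => z; rewrite expr0z scale1r.
  apply/matrixP => i j; rewrite !mxE.
  rewrite (_ : (fun z => _) = (fun z : T => A i j * (sval z ^ (k - n))%R)); last first.
    by apply/funext => z; rewrite mxE mulrC.
  rewrite cintegralZ ?cintegral_exprz ?mulr0// ?subr_eq0 1?eq_sym//.
  rewrite (_ : (fun z => _) = (fun z : T => (sval z ^ (k - n))%R * 1)).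
    by apply: cintegrable_shift; split; exact: rintegrable_cst.
  by apply/funext => z; rewrite mulr1.
by apply/funext => z; rewrite /monomial scalerA -expfzDr ?circle_neq0// addrC.
Qed.

Lemma fourier_cst A n : fourier (fun=> A) n = if n == 0 then A else 0.
Proof.
rewrite (_ : (fun=> A) = monomial 0 A) ?fourier_monomial//.
by apply/funext => z; rewrite /monomial expr0z scale1r.
Qed.

Lemma fourierB f g n : L2 f -> L2 g ->
  fourier (fun z => f z - g z) n = fourier f n - fourier g n.
Proof.
move=> f2 g2; rewrite !fourier_gram//; last exact: L2B.
by rewrite gramBl//; exact: L2_monomial.
Qed.

Lemma fourierMr f A n : L2 f -> fourier (fun z => f z *m A) n = fourier f n *m A.
Proof.
move=> f2; rewrite !fourier_gram//; last exact: L2Mr.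
by rewrite gramMr//; exact: L2_monomial.
Qed.

Lemma fourier_sum (I : Type) (s : seq I) (f : I -> T -> M) n :
  (forall i, L2 (f i)) ->
  fourier (fun z => \sum_(i <- s) f i z) n = \sum_(i <- s) fourier (f i) n.
Proof.
move=> f2; rewrite fourier_gram; last exact: L2_sum.
rewrite gram_suml//; last exact: L2_monomial.
by apply: eq_bigr => i _; rewrite fourier_gram.
Qed.

Lemma fourier_shift f k n :
  fourier (fun z => (sval z ^ k)%R *: f z) n = fourier f (n - k).
Proof.
rewrite !fourierE; congr mintegral; apply/funext => z.
by rewrite scalerA -expfzDr ?circle_neq0// opprB addrC.
Qed.

Lemma ae_eq0_fourier f : L2 f -> (forall n, fourier f n = 0) ->
  {ae m, forall z, f z = 0}.
Proof.
move=> f2 f0.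
have H i j : {ae m, forall z, f z i j = 0}.
  apply: ae_eq0_of_fourier; first exact: mintegrable_L2.
  by move=> n; have := congr1 (fun A : M => A i j) (f0 (- n)); rewrite !mxE opprK.
have {}H : {ae m, forall z, forall ij : 'I_N * 'I_N, f z ij.1 ij.2 = 0}.
  by apply: filter_forall => -[i j]; exact: H.
by apply: filterS H => z fz; apply/matrixP => i j; rewrite mxE (fz (i, j)).
Qed.

Definition fourier_psum r f : T -> M := fun z => \sum_(n <- r) monomial n (fourier f n) z.

Lemma L2_fourier_psum r f : L2 (fourier_psum r f).
Proof. by apply: L2_sum => n; exact: L2_monomial. Qed.

Lemma fourier_fourier_psum r f n : uniq r ->
  fourier (fourier_psum r f) n = if n \in r then fourier f n else 0.
Proof.
move=> ur; rewrite fourier_sum; last by move=> k; exact: L2_monomial.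
under eq_bigr do rewrite fourier_monomial.
case: ifPn => nr.
  by rewrite (bigD1_seq n)//= eqxx big1 ?addr0// => k kn; rewrite eq_sym (negPf kn).
rewrite big_seq big1// => k kr; case: eqP => // nk.
by move: nr; rewrite nk kr.
Qed.

Lemma gram_fourier_psum r f g : L2 g ->
  gram (fourier_psum r f) g = \sum_(n <- r) (fourier g n)^t* *m fourier f n.
Proof.
move=> g2; rewrite gram_suml//; last by move=> n; exact: L2_monomial.
apply: eq_bigr => n _; rewrite gramC ?gram_monomial ?conjmxM ?conjmxK//.
exact: L2_monomial.
Qed.

Lemma nrm2_fourier_psum r f : uniq r ->
  nrm2 (fourier_psum r f) = \sum_(n <- r) hsnorm (fourier f n) ^+ 2.
Proof.
move=> ur; rewrite nrm2E ?gram_fourier_psum; try exact: L2_fourier_psum.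
rewrite (big_morph (@mxtrace C N) (@mxtraceD _ _) (mxtrace0 _ _)) Re_sum; apply: eq_big_seq => n nr.
by rewrite fourier_fourier_psum// nr trace_abs2.
Qed.

(** Pythagoras: f minus its partial sum is orthogonal to the partial sum, so the difference of the
    two sides is a squared norm. *)
Lemma Bessel r f : uniq r -> L2 f ->
  \sum_(n <- r) hsnorm (fourier f n) ^+ 2 <= nrm2 f.
Proof.
move=> ur f2; have s2 := L2_fourier_psum r f.
rewrite -nrm2_fourier_psum// -subr_ge0.
rewrite (_ : _ - _ = nrm2 (fun z => f z - fourier_psum r f z)) ?nrm2_ge0//.
have sf : gram (fourier_psum r f) f = gram (fourier_psum r f) (fourier_psum r f).
  rewrite !gram_fourier_psum//; apply: eq_big_seq => n nr.
  by rewrite fourier_fourier_psum// nr.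
rewrite !nrm2E//; last exact: L2B.
rewrite gramBl ?gramBr//; last exact: L2B.
have fs : gram f (fourier_psum r f) = gram (fourier_psum r f) (fourier_psum r f).
  by rewrite gramC// sf -gramC.
rewrite sf fs subrr subr0 mxtraceD ReD.
by rewrite (raddfN (@mxtrace C N)) ReN.
Qed.

Definition nrm_cvg (s : nat -> T -> M) f := forall e : R, 0 < e ->
  exists k0, forall k, (k0 <= k)%N -> nrm (fun z => f z - s k z) <= e.

Lemma le0_of_small (x K : R) : (forall e, 0 < e -> x <= K * e) -> x <= 0.
Proof.
move=> H; case: leP => // x0.
have K1 : 0 < `|K| + 1 by rewrite ltr_pwDr.
(* With this e the hypothesis yields x <= x / 2. The sign of [K] is unknown, hence the absolute
   value, and 1 keeps the denominator positive. *)
have := H (x / (2 * (`|K| + 1))) (divr_gt0 x0 (mulr_gt0 (ltr0n _ 2) K1)).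
move=> xle; suff : x <= x / 2 by lra.
apply: le_trans xle _; rewrite mulrCA ler_wpM2l ?(ltW x0)// ler_pdivrMr ?mulr_gt0//.
by rewrite mulrA mulVf// mul1r (le_trans (ler_norm K))// lerDl.
Qed.

(** Continuity of [gram] in its first argument, for pairings that are eventually constant. It
    transfers to limits every identity that holds for partial sums. *)
Lemma gram_lim (s : nat -> T -> M) f g A k1 : (forall k, L2 (s k)) -> L2 f -> L2 g ->
  nrm_cvg s f -> (forall k, (k1 <= k)%N -> gram (s k) g = A) -> gram f g = A.
Proof.
move=> s2 f2 g2 sf sA; apply/eqP; rewrite -subr_eq0; apply/eqP/hsnorm_eq0/eqP.
rewrite eq_le hsnorm_ge0 andbT.
apply: (@le0_of_small _ ((N ^ 2 * 2)%:R * nrm g)) => e /sf[k0 H].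
pose k := maxn k0 k1.
rewrite -(sA k (leq_maxr _ _)) -gramBl//.
apply: le_trans (hsnorm_gram (L2B f2 (s2 k)) g2) _.
rewrite -mulrA ler_wpM2l ?ler0n// mulrC ler_wpM2l ?nrm_ge0//.
exact: H (leq_maxl _ _).
Qed.

Definition int_range (a k : nat) : seq int := [seq Posz j | j <- iota a k].

Lemma uniq_int_range a k : uniq (int_range a k).
Proof. by rewrite map_inj_uniq ?iota_uniq// => i j []. Qed.

Lemma mem_int_range a k n : (n \in int_range a k) = (a%:Z <= n < (a + k)%:Z).
Proof.
apply/mapP/idP => [[j]|].
  by rewrite mem_iota => /andP[aj jk] ->; rewrite lez_nat ltz_nat aj.
case: n => j; last by rewrite andbC.
by rewrite lez_nat ltz_nat => ajk; exists j => //; rewrite mem_iota.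
Qed.

(** Riesz-Fischer: squared distances of partial sums are differences of the sums of |f^(n)|^2, which
    Bessel bounds, so the partial sums are Cauchy. With a = 1 the limit is the projection of [f]
    onto [H20]. *)
Lemma fourier_projection a f : L2 f -> exists2 g, L2 g &
  (forall n, fourier g n = if a%:Z <= n then fourier f n else 0) /\
  nrm_cvg (fun k => fourier_psum (int_range a k) f) g.
Proof.
move=> f2; pose s k := fourier_psum (int_range a k) f.
have s2 k : L2 (s k) by exact: L2_fourier_psum.
pose S k := \sum_(n <- int_range a k) hsnorm (fourier f n) ^+ 2.
have catr p q : (p <= q)%N -> int_range a q = int_range a p ++ int_range (a + p) (q - p).
  by move=> pq; rewrite /int_range -map_cat -iotaD subnKC.
have dS p q : (p <= q)%N -> nrm2 (fun z => s q z - s p z) = S q - S p.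
  move=> pq; rewrite /S (catr _ _ pq) big_cat/= addrAC subrr add0r.
  rewrite -nrm2_fourier_psum ?uniq_int_range//; congr nrm2; apply/funext => z.
  by rewrite /s /fourier_psum (catr _ _ pq) big_cat/= addrAC subrr add0r.
have mS : {homo S : p q / (p <= q)%N >-> p <= q}.
  by move=> p q pq; rewrite -subr_ge0 -dS// nrm2_ge0.
have cS : cvgn S.
  apply: nondecreasing_is_cvgn => //; exists (nrm2 f) => _ [k _ <-].
  by apply: Bessel => //; exact: uniq_int_range.
have SL k : S k <= limn S by exact: nondecreasing_cvgn_le.
have [g g2 gs] : exists2 g, L2 g & forall e : R, 0 < e -> exists k0,
    forall k, (k0 <= k)%N -> nrm2 (fun z => g z - s k z) <= e.
  apply: L2_complete => // e e0.
  have /cvgrPdist_le/(_ e e0)[k0 _ H] := cS.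
  exists k0 => p q; wlog pq : p q / (q <= p)%N => [W kp kq|kp kq].
    have [qp|/ltnW pq] := leqP q p; first exact: W.
    rewrite -[leLHS]nrm_sqr -nrmN nrm_sqr.
    rewrite (_ : (fun z => _) = (fun z => s q z - s p z)); first exact: W.
    by apply/funext => z; rewrite opprB.
  rewrite dS//; have /= := H q kq.
  rewrite ger0_norm ?subr_ge0//; apply: le_trans.
  by rewrite lerD2r.
have gn : nrm_cvg s g.
  move=> e e0; have [k0 H] := gs _ (exprn_gt0 2 e0); exists k0 => k kk.
  by rewrite -ler_sqr ?nnegrE ?nrm_ge0 ?(ltW e0)// nrm_sqr; exact: H.
exists g => //; split => // n; rewrite fourier_gram//.
(* From this index on, [int_range a k] contains n as soon as a <= n, so the coefficient of the
   partial sum no longer changes. *)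
apply: (gram_lim (k1 := `|n|.+1)) s2 g2 (L2_monomial _ _) gn _ => k nk.
rewrite -fourier_gram; last exact: L2_fourier_psum.
rewrite /s fourier_fourier_psum ?uniq_int_range// mem_int_range.
case: (leP a%:Z n) => //= an; rewrite ifT//.
case: n an nk => // j; rewrite lez_nat ltz_nat => aj jk.
exact: leq_trans jk (leq_addl _ _).
Qed.

(** The partial sums converge to a function with the same coefficients as [f]; uniqueness of Fourier
    coefficients identifies it with [f]. *)
Lemma fourier_psum_cvg a f : L2 f -> (forall n, n < a%:Z -> fourier f n = 0) ->
  nrm_cvg (fun k => fourier_psum (int_range a k) f) f.
Proof.
move=> f2 f0; have [g g2 [gf gn]] := fourier_projection a f2.
have fg : {ae m, forall z, f z - g z = 0}.
  apply: ae_eq0_fourier; first exact: L2B.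
  move=> n; rewrite fourierB// gf; case: leP => [_|/f0 ->]; first by rewrite subrr.
  by rewrite subrr.
move=> e /gn[k0 H]; exists k0 => k /H; apply: le_trans.
have s2 := L2_fourier_psum (int_range a k) f.
rewrite (nrm_ae (L2B f2 s2) (L2B g2 s2))//.
by apply: filterS fg => z /eqP; rewrite subr_eq0 => /eqP ->.
Qed.

End FourierSeries.

(** * Hardy spaces *)

Section Hardy.
Variables (R : realType) (N : nat).
Local Notation T := (circle R).
Local Notation m := (@circle_measure R).
Local Notation C := R[i].
Local Notation M := 'M[C]_N.
Implicit Types (f g h F G D : T -> M) (n : int) (A B : M).

(** At z = 0 only the term n = 0 survives, so the partial sums are constant from length 1 on. *)
Lemma holext0 F : holext F 0 = fourier F 0.
Proof.
apply: cvg_lim; first exact: norm_hausdorff.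
apply: cvg_near_cst; exists 1%N => // k /= k1.
rewrite (bigD1 (Ordinal k1))//= expr0 scale1r big1 ?addr0// => i i0.
by rewrite expr0n; case: i i0 => [[|i] ik] //= _; rewrite scale0r.
Qed.

Lemma nrm_cst A : nrm (fun=> A) = hsnorm A.
Proof.
rewrite /nrm nrm2.unlock Rintegral_circle_cst sqrtr_sqr ger0_norm//.
exact: hsnorm_ge0.
Qed.

(** The measure being a probability, constants embed isometrically in [L2], whose triangle
    inequality is already known. *)
Lemma hsnorm_triangle A B : hsnorm (A + B) <= hsnorm A + hsnorm B.
Proof. by rewrite -!nrm_cst; apply: nrm_triangle; exact: L2_cst. Qed.

(** Matrices carry the topology of the largest entry, with norms and tolerances in [R[i]]. A
    positive element of [R[i]] is real, and each entry is bounded by the Hilbert-Schmidt norm. *)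
Lemma cvg_mx_hsnorm (s : nat -> M) A :
  (forall e : R, 0 < e -> exists k0, forall k, (k0 <= k)%N -> hsnorm (A - s k) <= e) ->
  s k @[k --> \oo] --> A.
Proof.
move=> H; apply/cvgrPdist_le => eps eps0.
have epsE : eps = (complex.Re eps)%:C.
  by case: eps eps0 => a b; rewrite ltcE/= => /andP[/eqP ->].
have e0 : 0 < complex.Re eps by move: eps0; rewrite epsE ltcR.
have [k0 Hk0] := H _ e0; exists k0 => // k /Hk0 le_e.
rewrite epsE [leLHS](_ : _ = mx_norm (A - s k))//.
have [->|/mx_norm_neq0[ij ->]] := eqVneq (mx_norm (A - s k)) 0.
  by rewrite ler0c ltW.
apply: (@le_trans _ _ (hsnorm (A - s k))%:C); last by rewrite lecR.
rewrite normc_def lecR -[leRHS]ger0_norm ?hsnorm_ge0// -sqrtr_sqr ler_wsqrtr//.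
exact: sqmod_le_hsnorm.
Qed.

Lemma H20_L2 f : H20 f -> L2 f. Proof. by case. Qed.

Lemma H2_L2 f : H2 f -> L2 f. Proof. by case. Qed.

Lemma H20_Mr f A : H20 f -> H20 (fun z => f z *m A).
Proof.
move=> [f2 f0]; split; first exact: L2Mr.
by move=> n n0; rewrite fourierMr// f0// mul0mx.
Qed.

Lemma H2_shift_H20 f : H2 f -> H20 (fun z => (sval z ^ 1)%R *: f z).
Proof.
move=> [f2 f0]; split; first exact: L2_shift.
by move=> n n0; rewrite fourier_shift f0//; lia.
Qed.

Lemma H20_monomial n A : 0 < n -> H20 (monomial n A).
Proof.
move=> n0; split; first exact: L2_monomial.
by move=> k k0; rewrite fourier_monomial; case: eqP => // kn; lia.
Qed.

(** The partial sums of [h] involve only the frequencies n >= 1, at which [f] has no coefficient,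
    and they converge to [h]. *)
Lemma gram_H20_eq0 f h : L2 f -> (forall n, 0 < n -> fourier f n = 0) -> H20 h ->
  gram f h = 0.
Proof.
move=> f2 f0 [h2 h0]; rewrite gramC//.
rewrite (_ : gram h f = 0); first by apply/matrixP => i j; rewrite !mxE conjC0.
have hn : forall n, n < 1%N -> fourier h n = 0 by move=> n n1; apply: h0; lia.
apply: (gram_lim (k1 := 0) _ h2 f2 (fourier_psum_cvg h2 hn)) => [k|k _].
  exact: L2_fourier_psum.
rewrite gram_fourier_psum// big_seq big1// => n.
rewrite mem_int_range => /andP[n1 _]; rewrite f0 ?lt_def//; last by lia.
rewrite (_ : 0^t* = 0) ?mul0mx//.
by apply/matrixP => i j; rewrite !mxE conjC0.
Qed.

(** [xget] needs a witness: the truncation of the Fourier series of [f] to n >= 1. The defining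
    orthogonality is scalar; applying it to [h] times elementary matrices gives the matrix-valued
    one. *)
Lemma PplusP f : L2 f ->
  H20 (Pplus f) /\ forall h, H20 h -> gram (fun z => f z - Pplus f z) h = 0.
Proof.
move=> f2; have [g g2 [gf _]] := fourier_projection 1 f2.
have g20 : H20 g.
  by split => // n n0; rewrite gf; case: ifP => //; lia.
have go h : H20 h -> innerL2 (fun z => f z - g z) h = 0.
  move=> h2; rewrite innerL2E; [|exact: L2B|exact: H20_L2].
  rewrite gram_H20_eq0 ?mxtrace0//; first exact: L2B.
  by move=> n n0; rewrite fourierB// gf; case: ifP; rewrite ?subrr//; lia.
rewrite /Pplus; case: xgetP => [p _ [p2 po]|/(_ g)]; last by case.
split => // h h2; apply/matrixP => i j; rewrite [RHS]mxE.
rewrite gram_entry; [|exact/L2B/H20_L2|exact: H20_L2].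
rewrite -innerL2E; [|exact/L2B/H20_L2|exact/L2Mr/H20_L2].
by apply: po; exact: H20_Mr.
Qed.

Lemma L2_Pplus f : L2 f -> L2 (Pplus f).
Proof. by move=> /PplusP[/H20_L2]. Qed.

Lemma gram_Pplus f h : L2 f -> H20 h -> gram (Pplus f) h = gram f h.
Proof.
move=> f2 h2; have [_ /(_ h h2)] := PplusP f2.
rewrite gramBl//; [|exact: L2_Pplus|exact: H20_L2].
by move/eqP; rewrite subr_eq0 => /eqP.
Qed.

Lemma nrm_Pplus f : L2 f -> nrm (Pplus f) <= nrm f.
Proof.
move=> f2; have p2 := L2_Pplus f2; rewrite ler_sqrt ?nrm2_ge0//.
rewrite [leRHS](_ : _ = nrm2 (fun z => (f z - Pplus f z) + Pplus f z)); last first.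
  by congr nrm2; apply/funext => z; rewrite subrK.
rewrite nrm2D//; last exact: L2B.
rewrite (PplusP f2).2 ?mxtrace0 ?mulr0 ?addr0 ?lerDr ?nrm2_ge0//.
by case: (PplusP f2).
Qed.

(** The coefficient of order n of F G is the pairing of G with z^n F^*, hence continuous in G, and G
    may be replaced by its partial sums. The term z^j G^(j) contributes F^(n - j) G^(j), which for j
    >= 0 >= n vanishes unless j = n = 0. *)
Lemma fourier_mulmx_H2 F G n : H2 F -> H2 G -> n <= 0 ->
  fourier (fun z => F z *m G z) n = if n == 0 then fourier F 0 *m fourier G 0 else 0.
Proof.
move=> [F2 F0] [G2 G0] n0.
have E H : mintegral (fun z => (sval z ^ (- n))%R *: (F z *m H z)) =
    gram H (fun z => (sval z ^ n)%R *: (F z)^t*).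
  rewrite gramE; congr mintegral; apply/funext => z.
  by rewrite conjmxZ conjmxK [X in X *: _ *m _]circle_conjXz -scalemxAl.
rewrite fourierE E.
have F2' : L2 (fun z => (sval z ^ n)%R *: (F z)^t*) by exact/L2_shift/L2J.
apply: (gram_lim (k1 := 1) _ G2 F2' (fourier_psum_cvg G2 G0)) => [k|k k1].
  exact: L2_fourier_psum.
rewrite /fourier_psum (gram_suml _ (fun j => L2_monomial j (fourier G j)) F2').
have T1 j : gram (monomial j (fourier G j)) (fun z => (sval z ^ n)%R *: (F z)^t*) =
    fourier F (n - j) *m fourier G j.
  rewrite -E (fourierE F) -mintegralMr; last exact/mintegrable_L2/L2_shift.
  congr mintegral; apply/funext => z.
  rewrite /monomial -scalemxAr scalerA -expfzDr ?circle_neq0// -scalemxAl.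
  by rewrite opprB addrC.
under eq_bigr do rewrite T1.
case: k k1 => // k _; rewrite /int_range /= big_cons subr0 big_map big_seq big1.
  by rewrite addr0; case: eqP => [->//|nn]; rewrite F0 ?mul0mx//; lia.
by move=> j; rewrite mem_iota => /andP[j1 _]; rewrite F0 ?mul0mx//; lia.
Qed.

Lemma H2_mulmx F G : H2 F -> H2 G -> L2 (fun z => F z *m G z) ->
  H2 (fun z => F z *m G z).
Proof.
move=> F2 G2 FG2; split => // n n0.
by rewrite fourier_mulmx_H2// ?ltW// (lt_eqF n0).
Qed.

(** By the triangle inequality, distances between partial sums are dominated by those of the scalar
    geometric series, so completeness applies. *)
Lemma L2_geometric_series (u : nat -> T -> M) (K d : R) : (forall k, L2 (u k)) ->
  0 <= d < 1 -> (forall k, nrm (u k) <= K * d ^+ k) ->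
  exists2 S, L2 S & nrm_cvg (fun k z => \sum_(i < k) u i z) S.
Proof.
move=> u2 /andP[d0 d1] uK; pose s k z := \sum_(i < k) u i z.
have s2 k : L2 (s k) by exact: L2_sum.
pose a := series (geometric K d).
have ca : cvgn a by apply: is_cvg_geometric_series; rewrite ger0_norm.
have K0 k : 0 <= K * d ^+ k by apply: le_trans (uK k); exact: nrm_ge0.
have aS k : a k.+1 = a k + K * d ^+ k by rewrite /a /series/= big_nat_recr.
have aL k : a k <= limn a.
  apply: nondecreasing_cvgn_le ca _.
  by apply/nondecreasing_seqP => i; rewrite aS lerDl.
have sa p j : nrm (fun z => s (p + j)%N z - s p z) <= a (p + j)%N - a p.
  elim: j => [|j IH].
    rewrite addn0 subrr (_ : (fun z => _) = fun=> 0) ?nrm_cst ?hsnorm0//.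
    by apply/funext => z; rewrite subrr.
  rewrite addnS aS addrAC.
  rewrite (_ : (fun z => _) = (fun z => (s (p + j)%N z - s p z) + u (p + j)%N z)).
    apply: le_trans (nrm_triangle (L2B (s2 _) (s2 _)) (u2 _)) _.
    by rewrite lerD.
  by apply/funext => z; rewrite /s big_ord_recr /= addrAC.
have [S S2 HS] : exists2 S, L2 S & forall e : R, 0 < e -> exists k0,
    forall k, (k0 <= k)%N -> nrm2 (fun z => S z - s k z) <= e.
  apply: L2_complete => // e e0.
  have se0 : 0 < Num.sqrt e by rewrite sqrtr_gt0.
  have /cvgrPdist_le/(_ _ se0)[k0 _ H] := ca.
  exists k0 => p q; wlog pq : p q / (q <= p)%N => [W kp kq|kp kq].
    have [qp|/ltnW pq] := leqP q p; first exact: W.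
    rewrite -[leLHS]nrm_sqr -nrmN nrm_sqr.
    rewrite (_ : (fun z => _) = (fun z => s q z - s p z)); first exact: W.
    by apply/funext => z; rewrite opprB.
  rewrite -nrm_sqr -[leRHS](sqr_sqrtr (ltW e0)) ler_sqr ?nnegrE ?nrm_ge0 ?sqrtr_ge0//.
  rewrite -(subnKC pq); apply: le_trans (sa _ _) _; have /= := H q kq.
  rewrite ger0_norm ?subr_ge0//; apply: le_trans.
  by rewrite lerD2r.
exists S => // e e0; have [k0 H] := HS _ (exprn_gt0 2 e0); exists k0 => k kk.
by rewrite -ler_sqr ?nnegrE ?nrm_ge0 ?(ltW e0)// nrm_sqr; exact: H.
Qed.

End Hardy.

(** * The Neumann series and the outer factor *)

Section Perturbation.
Variables (R : realType) (N : nat).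
Local Notation T := (circle R).
Local Notation m := (@circle_measure R).
Local Notation C := R[i].
Local Notation M := 'M[C]_N.
Variables (D : T -> M) (d : R).
Hypothesis mD : measurable_mx D.
Hypothesis saD : {ae m, forall z, (D z)^t* = D z}.
Hypothesis d01 : 0 <= d < 1.
Hypothesis Dd : {ae m, forall z, opnorm (D z) <= d}.
Variable e : R.
Hypothesis e01 : 0 <= e <= 1.
Implicit Types (f g h F G S : T -> M).

Let I1 : T -> M := fun=> 1%:M.
Let W := perturbation D e.
Let P := Pplus D.

Let L2I : L2 I1. Proof. exact: L2_cst. Qed.

Let L2D_mul f : L2 f -> L2 (fun z => D z *m f z).
Proof. by move=> f2; exact: L2M_bounded Dd. Qed.

Let L2_D : L2 D.
Proof. by have := L2D_mul L2I; rewrite /I1; under eq_fun do rewrite mulmx1. Qed.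

Let nrmD_mul f : L2 f -> nrm (fun z => D z *m f z) <= d * nrm f.
Proof.
by move=> f2; apply: nrm_bounded_mul Dd => //; case/andP: d01.
Qed.

Let gramD_adj f g : L2 f -> L2 g ->
  gram (fun z => D z *m f z) g = gram f (fun z => D z *m g z).
Proof.
move=> f2 g2; rewrite gram_adj; apply: gram_ae; try exact: L2_measurable.
- exact: measurable_mxM (measurable_mxJ mD) (L2_measurable g2).
- exact/L2_measurable/L2D_mul.
- exact: aeW.
- by apply: filterS saD => z ->.
Qed.

Let H20_iter n : H20 (iter n (toeplitz D) P).
Proof.
case: n => [|n]; first by case: (PplusP L2_D).
rewrite iterS; elim: n => [|n IH].
  by have [] := PplusP (L2D_mul (L2_Pplus L2_D)).
by have [] := PplusP (L2D_mul (H20_L2 IH)).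
Qed.

Let nrm_iter n : nrm (iter n (toeplitz D) P) <= nrm P * d ^+ n.
Proof.
elim: n => [|n IH]; first by rewrite expr0 mulr1.
have v2 := H20_L2 (H20_iter n).
rewrite iterS; apply: le_trans (nrm_Pplus (L2D_mul v2)) _.
apply: le_trans (nrmD_mul v2) _; rewrite exprS mulrCA ler_wpM2l//.
by case/andP: d01.
Qed.

Let c n : C := (-1) ^+ n * e%:C ^+ n.+1.

Let cE n : c n = ((-1) ^+ n * e ^+ n.+1)%:C.
Proof. by rewrite /c rmorphM rmorphXn rmorphXn/= rmorphN1. Qed.

Let L2_term n : L2 (neumann_term D e n).
Proof. exact/L2Zc/H20_L2/H20_iter. Qed.

Lemma H20_neumann_term n : H20 (neumann_term D e n).
Proof.
split; first exact: L2_term.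
move=> k k0; have [v2 v0] := H20_iter n.
by rewrite fourier_gram ?gramZl -?fourier_gram ?v0 ?scaler0//; exact: L2_monomial.
Qed.

(** As e <= 1, the scalar coefficient has modulus at most 1; the decay comes entirely from |T_Delta
    f| <= d |f|. *)
Lemma nrm_neumann_term n : nrm (neumann_term D e n) <= nrm P * d ^+ n.
Proof.
case/andP: e01 => e0 e1; apply: le_trans (nrm_iter n).
rewrite ler_sqrt ?nrm2_ge0// nrm2Z; last exact/H20_L2/H20_iter.
rewrite ler_piMl ?nrm2_ge0// -/(c n) cE /sqmod/= expr0n addr0 exprMn.
by rewrite -exprM mulnC exprM sqrrN expr1n expr1n mul1r !exprn_ile1// exprn_ge0.
Qed.

Lemma neumann_sum : exists2 S, H20 S &
  nrm_cvg (fun k z => \sum_(i < k) neumann_term D e i z) S.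
Proof.
have [S S2 cS] := L2_geometric_series L2_term d01 nrm_neumann_term.
exists S => //; split=> // n n0; rewrite fourier_gram//.
apply: (gram_lim (k1 := 0) _ S2 (L2_monomial n 1%:M) cS) => [k|k _].
  exact: L2_sum.
rewrite (gram_sum_ord _ L2_term (L2_monomial n 1%:M)) big1// => i _.
by have [t2 t0] := H20_neumann_term i; rewrite -fourier_gram// t0.
Qed.

Section Sum.
Variable S : T -> M.
Hypothesis H20S : H20 S.
Hypothesis cvgS : nrm_cvg (fun k z => \sum_(i < k) neumann_term D e i z) S.

Let L2S : L2 S. Proof. exact: H20_L2. Qed.
Let s k z : M := \sum_(i < k) neumann_term D e i z.
Let L2s k : L2 (s k). Proof. exact: L2_sum. Qed.

(** Against [h] in [H20] the projection inside [toeplitz] disappears, so the term i + 1 pairs with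
    [h] like - e Delta times the term i. Summation is the weak form of s_(k+1) = e P_+ Delta - e
    T_Delta s_k. *)
Lemma neumann_partial k h : H20 h ->
  gram (s k.+1) h = e%:C *: gram D h - e%:C *: gram (fun z => D z *m s k z) h.
Proof.
move=> h2; have hL := H20_L2 h2.
have t0 : gram (neumann_term D e 0) h = e%:C *: gram D h.
  rewrite gramZl//; last exact: L2_Pplus.
  by rewrite expr0 mul1r expr1 gram_Pplus.
have tS i : gram (neumann_term D e i.+1) h =
    - (e%:C *: gram (fun z => D z *m neumann_term D e i z) h).
  have v2 := H20_L2 (H20_iter i).
  rewrite gramZl//; last exact/H20_L2/H20_iter.
  rewrite iterS gram_Pplus//; last exact: L2D_mul.
  rewrite (_ : (fun z => D z *m neumann_term D e i z) =
    (fun z => c i *: (D z *m iter i (toeplitz D) P z))).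
    rewrite gramZl//; last exact: L2D_mul.
    by rewrite scalerA -scaleNr; congr (_ *: _); rewrite /c !exprS; ring.
  by apply/funext => z; rewrite /neumann_term -scalemxAr.
have gs j : gram (s j) h = \sum_(i < j) gram (neumann_term D e i) h.
  exact: gram_sum_ord L2_term hL.
have gDs j : gram (fun z => D z *m s j z) h =
    \sum_(i < j) gram (fun z => D z *m neumann_term D e i z) h.
  rewrite gramD_adj// (gram_sum_ord _ L2_term (L2D_mul hL)).
  by apply: eq_bigr => i _; rewrite gramD_adj.
have gsS : \sum_(i < k) gram (neumann_term D e (lift ord0 i)) h =
    - (e%:C *: \sum_(i < k) gram (fun z => D z *m neumann_term D e i z) h).
  rewrite scaler_sumr -sumrN; apply: eq_bigr => i _.
  by rewrite lift0 tS.
by rewrite (gs k.+1) big_ord_recl gsS (gDs k) [X in X - _ = _]t0.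
Qed.

(** Limit of [neumann_partial]: the two sides differ by pairings of S - s_(k+1) with h and of S -
    s_k with Delta h, both controlled by the convergence of the series. *)
Lemma neumann_equation h : H20 h ->
  gram S h = e%:C *: gram D h - e%:C *: gram (fun z => D z *m S z) h.
Proof.
move=> h2; have hL := H20_L2 h2; have DhL := L2D_mul hL.
apply/eqP; rewrite -subr_eq0; apply/eqP/hsnorm_eq0/eqP.
rewrite eq_le hsnorm_ge0 andbT; case/andP: e01 => e0 e1.
pose K : R := (N ^ 2 * 2)%:R.
apply: (@le0_of_small _ _ (K * nrm h + K * nrm (fun z => D z *m h z))) => t t0.
have [k0 H] := cvgS t0.
have Hk : nrm (fun z => S z - s k0 z) <= t by exact: H.
have HSk : nrm (fun z => S z - s k0.+1 z) <= t by apply: H; exact: leqnSn.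
have -> : gram S h - (e%:C *: gram D h - e%:C *: gram (fun z => D z *m S z) h) =
    gram (fun z => S z - s k0.+1 z) h +
    e%:C *: gram (fun z => S z - s k0 z) (fun z => D z *m h z).
  rewrite !gramBl// neumann_partial// !gramD_adj//.
  by apply/matrixP => i j; rewrite !mxE; ring.
apply: le_trans (hsnorm_triangle _ _) _; rewrite mulrDl; apply: lerD.
  apply: le_trans (hsnorm_gram (L2B L2S (L2s _)) hL) _.
  by rewrite -mulrA ler_wpM2l ?ler0n// mulrC ler_wpM2l ?nrm_ge0.
rewrite hsnorm_scaleR//; apply: le_trans (ler_piMl (hsnorm_ge0 _) e1) _.
apply: le_trans (hsnorm_gram (L2B L2S (L2s _)) DhL) _.
by rewrite -mulrA ler_wpM2l ?ler0n// mulrC ler_wpM2l ?nrm_ge0.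
Qed.

Let G z : M := 1%:M - S z.
Let L2G : L2 G. Proof. exact: L2B. Qed.
Let Y z : M := W z *m G z.
Let DS2 : L2 (fun z => D z *m S z). Proof. exact: L2D_mul. Qed.

Let YE : Y = (fun z => (1%:M - S z) + (e%:C *: D z - e%:C *: (D z *m S z))).
Proof.
apply/funext => z; rewrite /Y /W /G /perturbation mulmxDl mul1mx.
by rewrite -scalemxAl mulmxBr mulmx1 scalerBr.
Qed.

Let L2Y : L2 Y.
Proof. by rewrite YE; apply: L2D => //; apply: L2B; exact: L2Zc. Qed.

Let gramY h : L2 h -> gram Y h = (gram I1 h - gram S h) +
  (e%:C *: gram D h - e%:C *: gram (fun z => D z *m S z) h).
Proof.
move=> h2; have eD := L2Zc e%:C L2_D; have eDS := L2Zc e%:C DS2.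
by rewrite YE (gramDl L2G (L2B eD eDS) h2) (gramBl L2I L2S h2) (gramBl eD eDS h2) !gramZl.
Qed.

(** W G = I - S + e Delta - e Delta S. The constant I is orthogonal to [H20], and the Neumann
    equation says that the other terms cancel. *)
Lemma gram_weight_H20 h : H20 h -> gram Y h = 0.
Proof.
move=> h2; have hL := H20_L2 h2; rewrite gramY// neumann_equation//.
rewrite gram_H20_eq0//; first by rewrite sub0r addNr.
by move=> n n0; rewrite fourier_cst gt_eqF.
Qed.

Let H2G : H2 G.
Proof.
split=> // n n0; rewrite fourierB// fourier_cst (lt_eqF n0).
by have [_ ->] := H20S; rewrite ?subr0// ltW.
Qed.

Let G0 : fourier G 0 = 1%:M.
Proof. by rewrite fourierB// fourier_cst; have [_ ->] := H20S; rewrite ?subr0. Qed.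

(** * The product of the outer function with [G], and its constant value *)

Section Outer.
Variable F : T -> M.
Hypothesis outerF : right_outer W F.

Let F2 : H2 F. Proof. by case: outerF. Qed.
Let LF : L2 F. Proof. exact: H2_L2. Qed.

Let WF : {ae m, forall z, (F z)^t* *m F z = W z}. Proof. by case: outerF. Qed.

(** The trace of F^* F = W bounds |F|^2 by the second summand, each diagonal entry of W being at
    most 1 + |I|. Adding 1 bounds |F| itself without a square root: either |F| <= 1 or |F| <=
    |F|^2. *)
Let K : R := 1 + (N%:R * (1 + hsnorm (1%:M : M))).

Let F_bounded : {ae m, forall z, opnorm (F z) <= K}.
Proof.
apply: filterS2 WF Dd => z Fz Dz; apply: le_trans (opnorm_le_hsnorm _) _.
case/andP: e01 => e0 e1; case/andP: d01 => d0 d1.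
have DH : hsnorm (D z) <= hsnorm (1%:M : M).
  rewrite -[D z]mulmx1; apply: le_trans (hsnorm_opnorm _ _) _.
  by rewrite ler_piMl ?hsnorm_ge0// (le_trans Dz)// ltW.
have : hsnorm (F z) ^+ 2 <= N%:R * (1 + hsnorm (1%:M : M)).
  rewrite -trace_abs2 Fz Re_sum mulr_natl -[X in _ *+ X]card_ord -sumr_const.
  apply: ler_sum => i _; rewrite !mxE ReD eqxx/= lerD2l ReM/= mul0r subr0.
  apply: le_trans (_ : `|complex.Re (D z i i)| <= _).
    apply: le_trans (ler_norm _) _; rewrite normrM ger0_norm// ler_piMl//.
  by apply: le_trans DH; exact: normRe_le_hsnorm.
rewrite /K; have := hsnorm_ge0 (F z); set x := hsnorm _; set y := _ * _ => x0 xy.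
have [x1|x1] := leP x 1.
  by apply: le_trans x1 _; rewrite lerDl (le_trans _ xy)// sqr_ge0.
apply: (@le_trans _ _ (x ^+ 2)); first by rewrite expr2 ler_peMl// ltW.
by apply: le_trans xy _; rewrite lerDr.
Qed.

Let L2F_mul h : L2 h -> L2 (fun z => F z *m h z).
Proof. by move=> h2; apply: L2M_bounded F_bounded => //; exact: L2_measurable. Qed.

Let g z := F z *m G z.
Let L2g : L2 g. Proof. exact: L2F_mul. Qed.
Let H2g : H2 g. Proof. exact: H2_mulmx. Qed.
Let A := fourier F 0.
Let g0 : fourier g 0 = A. Proof. by rewrite fourier_mulmx_H2// G0 mulmx1. Qed.

(** The factor z^-1 turns orthogonality to z H^2 into orthogonality to H^2, the space in which F H^2
    is dense. *)
Let gbar (z : T) := (sval z ^ (-1))%R *: g z.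
Let L2gbar : L2 gbar. Proof. exact: L2_shift. Qed.

(* [<gbar, F h> = <F^* F G, z h> = <W G, z h> = 0]. *)
Let gbar_FH2 h : H2 h -> gram gbar (fun z => F z *m h z) = 0.
Proof.
move=> h2; have hL := H2_L2 h2; rewrite gram_shift opprK.
rewrite (_ : (fun z => _) = (fun z => F z *m ((sval z ^ 1)%R *: h z))); last first.
  by apply/funext => z; rewrite -scalemxAr.
have zh := H2_shift_H20 h2; rewrite -(gram_weight_H20 zh).
have mF := L2_measurable LF; have mh := L2_measurable (H20_L2 zh).
transitivity (gram (fun z => (F z)^t* *m g z) (fun z => (sval z ^ 1)%R *: h z)).
  rewrite [RHS]gram_adj; congr (gram g _).
  by apply/funext => z; rewrite conjmxK.
apply: gram_ae => //.
- exact: measurable_mxM (measurable_mxJ mF) (L2_measurable L2g).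
- exact: L2_measurable.
- by apply: filterS WF => z Wz; rewrite /g mulmxA Wz.
- exact: aeW.
Qed.

(** Density of F H^2: [gbar] annihilates F k, so its pairing with h has the size of its pairing with
    F k - h, which can be made arbitrarily small. *)
Let gbar_H2 h : H2 h -> gram gbar h = 0.
Proof.
move=> h2; have hL := H2_L2 h2; apply/hsnorm_eq0/eqP; rewrite eq_le hsnorm_ge0 andbT.
apply: (@le0_of_small _ _ ((N ^ 2 * 2)%:R * nrm gbar)) => t t0.
have [_ _ /(_ h h2 t t0)[k k2]] := outerF.
have kL := L2F_mul (H2_L2 k2); have dL := L2B kL hL.
rewrite normL2_nrm// lte_fin => /ltW nt.
have -> : hsnorm (gram gbar h) = hsnorm (gram gbar (fun z => F z *m k z - h z)).
  rewrite gramBr// gbar_FH2// sub0r -scaleN1r.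
  apply/eqP; rewrite -(@eqrXn2 _ 2) ?hsnorm_ge0// hsnorm_scale /sqmod/=.
  by rewrite oppr0 expr0n addr0 sqrrN expr1n mul1r.
apply: le_trans (hsnorm_gram L2gbar dL) _.
by rewrite mulrA ler_wpM2l// mulr_ge0 ?nrm_ge0.
Qed.

Lemma outer_mul_const : {ae m, forall z, F z *m G z = fourier F 0}.
Proof.
have cL := L2_cst A; have gcL := L2B L2g cL.
(* Dividing by z stays in H^2 because g - A has zero mean. Used as test function, it gives <g, g -
   A> = 0. *)
have h2 : H2 (fun z => (sval z ^ (-1))%R *: (g z - A)).
  split; first exact: L2_shift.
  move=> n n0; rewrite fourier_shift fourierB// fourier_cst opprK.
  have [_ gn] := H2g.
  have [->|n1] := eqVneq n (-1); first by rewrite addNr eqxx g0 subrr.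
  have n10 : n + 1 < 0 by lia.
  by rewrite gn// (lt_eqF n10) subrr.
have := gbar_H2 h2; rewrite gram_shift opprK.
rewrite (_ : (fun z => _) = (fun z => g z - A)); last first.
  by apply/funext => z; rewrite scalerA -expfzDr ?circle_neq0// subrr expr0z scale1r.
move=> gg.
(* Constants are orthogonal to g - A, again by its zero mean; together with the previous
   orthogonality this gives |g - A|^2 = 0. *)
have cc : gram (fun=> A) (fun z => g z - A) = 0.
  rewrite gramC// (_ : (fun=> A) = monomial 0 A); last first.
    by apply/funext => z; rewrite /monomial expr0z scale1r.
  rewrite gram_monomial// fourierB// fourier_cst eqxx g0 subrr mulmx0.
  by apply/matrixP => i j; rewrite !mxE conjC0.
have : nrm2 (fun z => g z - A) = 0.
  by rewrite nrm2E// gramBl// gg cc subrr mxtrace0.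
by move/(nrm2_eq0 gcL); apply: filterS => z /eqP; rewrite subr_eq0 => /eqP.
Qed.

Lemma abs2_outer : {ae m, forall z,
  abs2 (fourier F 0) = (1%:M - S z)^t* *m perturbation D e z *m (1%:M - S z)}.
Proof.
apply: filterS2 WF outer_mul_const => z Wz <-.
by rewrite /abs2 conjmxM -[perturbation D e z]Wz !mulmxA.
Qed.

Lemma abs2_outer_expansion : abs2 (fourier F 0) = 1%:M + e%:C *: fourier D 0 -
  (e ^+ 2)%:C *: (gram P P - gram (fun z => D z *m S z) P).
Proof.
have gI f : L2 f -> gram f I1 = fourier f 0.
  move=> f2; rewrite fourier_gram//; congr (gram f _).
  by apply/funext => z; rewrite /monomial expr0z scale1r.
have PL := L2_Pplus L2_D; have [P20 _] := PplusP L2_D.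
have -> : abs2 (fourier F 0) = gram Y G.
  rewrite gramE -[LHS]mintegral_cst; apply: ae_eq_mintegral.
  - exact: measurable_mx_cst.
  - exact: measurable_mxM (measurable_mxJ (L2_measurable L2G)) (L2_measurable L2Y).
  - by apply: filterS abs2_outer => z ->; rewrite mulmxA.
(* The integral of G^* W G is <W G, I> - <W G, S>, and the second pairing vanishes since S is in
   [H20]; only the mean of W G remains. *)
rewrite (gramBr L2I L2S L2Y) (gram_weight_H20 H20S) subr0 gramY// !gI//.
rewrite fourier_cst eqxx (_ : fourier S 0 = 0); last by case: H20S => _ ->.
(* The mean of Delta S is <S, Delta> = <S, P>, as S is in [H20]; the Neumann equation at h = P then
   brings out a second factor e. *)
have -> : fourier (fun z => D z *m S z) 0 =
    e%:C *: (gram P P - gram (fun z => D z *m S z) P).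
  rewrite -gI// gramD_adj// (_ : (fun z => D z *m I1 z) = D); last first.
    by apply/funext => z; rewrite mulmx1.
  rewrite gramC// -(gram_Pplus L2_D H20S) -gramC//.
  by rewrite (neumann_equation P20) -(gram_Pplus L2_D P20) scalerBr.
by rewrite subr0 scalerA -rmorphM -expr2 addrA.
Qed.

End Outer.

(** The Neumann equation at h = S gives |S|^2 <= e |Delta| |S| + d |S|^2, with e <= 1 used in the
    last term, which is then absorbed because d < 1. *)
Lemma nrm_neumann_sum : nrm S <= nrm D / (1 - d) * e.
Proof.
case/andP: e01 => e0 e1; case/andP: d01 => d0 d1.
have d10 : 0 < 1 - d by rewrite subr_gt0.
have [->|S0] := eqVneq (nrm S) 0.
  by rewrite mulr_ge0// divr_ge0 ?nrm_ge0// ltW.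
have S1 : 0 < nrm S by rewrite lt_def S0 nrm_ge0.
have ReZ (x : R) (B : M) : complex.Re (\tr (x%:C *: B)) = x * complex.Re (\tr B).
  by rewrite mxtraceZ ReM/= mul0r subr0.
have H : nrm S ^+ 2 <= e * (nrm D * nrm S) + d * nrm S * nrm S.
  rewrite nrm_sqr (nrm2E L2S) (neumann_equation H20S) mxtraceD ReD.
  rewrite -scaleNr -rmorphN !ReZ.
  apply: lerD; first by rewrite ler_wpM2l// CauchySchwarz_Re.
  rewrite mulNr -mulrN -ReN -(raddfN (@mxtrace C N)) -gramNl//.
  have NL := L2N DS2; apply: (@le_trans _ _ (e * (nrm (fun z => - (D z *m S z)) * nrm S))).
    by rewrite ler_wpM2l// CauchySchwarz_Re.
  rewrite nrmN; apply: (@le_trans _ _ (nrm (fun z => D z *m S z) * nrm S)).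
    by rewrite ler_piMl// mulr_ge0 ?nrm_ge0.
  by rewrite ler_wpM2r ?nrm_ge0// nrmD_mul.
have {}H : nrm S * (1 - d) <= nrm D * e.
  rewrite -(ler_pM2l S1) -subr_ge0; move: H; rewrite -subr_ge0.
  by congr (0 <= _); ring.
by rewrite mulrAC ler_pdivlMr.
Qed.

End Sum.
End Perturbation.

Theorem proposition1p2 (R : realType) (N : nat) (N_gt0 : (0 < N)%N)
    (Delta : circle R -> 'M[R[i]]_N)
    (Delta_measurable : measurable_mx Delta)
    (Delta_selfadjoint :
      {ae @circle_measure R, forall z, (Delta z)^t* = Delta z})
    (Delta_lt1 :
      (ess_sup (@circle_measure R) (fun z => (opnorm (Delta z))%:E) < 1)%E) :
  (forall e : R, 0 <= e <= 1 ->
     exists S : circle R -> 'M[R[i]]_N,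
       is_sum_H20 (neumann_term Delta e) S /\
       forall F : circle R -> 'M[R[i]]_N,
         is_normalized_outer (perturbation Delta e) F ->
         {ae @circle_measure R, forall z,
           abs2 (holext F 0) =
             (1%:M - S z)^t* *m perturbation Delta e z *m (1%:M - S z)}) /\
  (exists S2 : 'M[R[i]]_N,
     (\sum_(1 <= n < k) abs2 (fourier Delta n%:Z) @[k --> \oo] --> S2) /\
     exists C : R, \forall e \near (0 : R)^'+,
       forall F : circle R -> 'M[R[i]]_N,
         is_normalized_outer (perturbation Delta e) F ->
         opnorm (abs2 (holext F 0) -
                 (1%:M + e%:C *: fourier Delta 0 - (e ^+ 2)%:C *: S2))
           <= C * e ^+ 3).
Proof.
(* A real essential supremum is replaced by its maximum with 0 to ensure d >= 0. If it is -oo, the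
   pointwise bound is contradictory and d = 0 serves. *)
have [d d01 Dd] : exists2 d : R, 0 <= d < 1 &
    {ae @circle_measure R, forall z, opnorm (Delta z) <= d}.
  have : {ae @circle_measure R, forall z, ((opnorm (Delta z))%:E <=
      ess_sup (@circle_measure R) (fun z => (opnorm (Delta z))%:E))%E}.
    exact: ess_sup_ge.
  move: Delta_lt1; case: (ess_sup _ _) => [r r1 H|//|_ H].
    exists (Num.max 0 r); first by rewrite le_max lexx gt_max ltr01 -lte_fin.
    by apply: filterS H => z; rewrite lee_fin le_max orbC => ->.
  by exists 0; [rewrite lexx ltr01|apply: filterS H => z].
have D2 : L2 Delta.
  have := L2M_bounded Delta_measurable (L2_cst 1%:M) Dd.
  by under eq_fun do rewrite mulmx1.
pose P := Pplus Delta; have P2 : L2 P := L2_Pplus D2.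
have [P20 _] := PplusP D2.
split=> [e e01|].
  have [S H20S cvgS] := neumann_sum Delta_measurable d01 Dd e01.
  have t20 n : H20 (neumann_term Delta e n) by exact: H20_neumann_term Dd _ _.
  exists S; split.
    split=> //; rewrite (_ : (fun k => normL2 _) =
        (fun k => (nrm (fun z => S z - \sum_(n < k) neumann_term Delta e n z))%:E)).
      apply: cvgr_EFin; apply/cvgrPdist_le => t t0.
      have [k0 H] := cvgS t t0; exists k0 => // k kk.
      by rewrite /= sub0r normrN ger0_norm ?nrm_ge0//; exact: H.
    apply/funext => k; rewrite normL2_nrm//; apply: L2B; first exact: H20_L2.
    by apply: L2_sum => i; exact: H20_L2.
  move=> F [outerF _]; rewrite holext0.
  exact: (abs2_outer Delta_measurable Delta_selfadjoint d01 Dd e01 H20S cvgS outerF).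
pose K : R := (N ^ 2 * 2)%:R; have K0 : 0 <= K by rewrite ler0n.
(* By Parseval <P, P> is the sum of the |Delta^(n)|^2 over n >= 1: [P] has the coefficients of Delta
   at positive frequencies and none elsewhere. *)
exists (gram P P); split.
  have fP (n : int) : 0 < n -> fourier P n = fourier Delta n.
    move=> n0; rewrite !fourier_gram// gram_Pplus//.
    exact: H20_monomial.
  have psE k : \sum_(1 <= n < k) abs2 (fourier Delta n%:Z) =
      gram (fourier_psum (int_range 1 (k - 1)) P) P.
    rewrite gram_fourier_psum// /int_range big_map -/(index_iota 1 k) !big_nat.
    by apply: eq_bigr => n /andP[n1 _]; rewrite fP// ltz_nat.
  apply: cvg_mx_hsnorm => t t0.
  (* The tolerance t is divided by this quantity; adding 1 keeps it nonzero when P = 0. *)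
  have Kt : 0 < K * nrm P + 1 by rewrite ltr_pwDr// mulr_ge0 ?nrm_ge0.
  have Pn (n : int) : n < 1%N -> fourier P n = 0.
    by move=> n1; have [_ ->] := P20 => //; lia.
  have [k0 H] := fourier_psum_cvg P2 Pn (divr_gt0 t0 Kt).
  exists k0.+1 => k k0k; rewrite psE -gramBl//; last exact: L2_fourier_psum.
  have /H {}H : (k0 <= k - 1)%N by lia.
  apply: le_trans (hsnorm_gram (L2B P2 (L2_fourier_psum _ _)) P2) _.
  apply: (@le_trans _ _ (K * (t / (K * nrm P + 1) * nrm P))).
    by rewrite ler_wpM2l// ler_wpM2r ?nrm_ge0.
  rewrite mulrCA mulrAC ler_pdivrMr// ler_wpM2l ?(ltW t0)//.
  by rewrite lerDl.
(* The bound |<Delta S, P>| <= K |S| |P| combined with |S| <= e |Delta| / (1 - d). It depends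
   neither on e nor on the outer function. *)
exists (K * (nrm Delta / (1 - d) * nrm P)); near=> e => F [outerF _].
have e0 : 0 < e by [].
have e01 : 0 <= e <= 1.
  by rewrite ltW//=; near: e; exact: nbhs_right_le.
have [S H20S cvgS] := neumann_sum Delta_measurable d01 Dd e01.
have S2 := H20_L2 H20S.
rewrite holext0 (abs2_outer_expansion Delta_measurable Delta_selfadjoint d01 Dd e01
  H20S cvgS outerF) -/P.
set Q := gram (fun z => Delta z *m S z) P.
(* The expansion being exact, the remainder is e^2 <Delta S, P>, and the third factor e comes from
   the size of S. *)
rewrite (_ : _ - _ = (e ^+ 2)%:C *: Q); last first.
  by apply/matrixP => i j; rewrite !mxE; ring.
apply: le_trans (opnorm_le_hsnorm _) _.
case/andP: (d01) => d0 d1.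
rewrite hsnorm_scaleR ?sqr_ge0//.
have -> : K * (nrm Delta / (1 - d) * nrm P) * e ^+ 3 =
    e ^+ 2 * (K * (nrm Delta / (1 - d) * e * nrm P)) by ring.
rewrite ler_wpM2l ?sqr_ge0//.
have DS2 := L2M_bounded Delta_measurable S2 Dd.
apply: le_trans (hsnorm_gram DS2 P2) _; rewrite ler_wpM2l// ler_wpM2r ?nrm_ge0//.
apply: le_trans (nrm_bounded_mul Delta_measurable S2 d0 Dd) _.
apply: le_trans (ler_piMl (nrm_ge0 S) (ltW d1)) _.
exact: (nrm_neumann_sum Delta_measurable Delta_selfadjoint d01 Dd e01 H20S cvgS).
Unshelve. all: by end_near.
Qed.
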